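(* Let $G\dashv R$ be a monoidal adjunction with $G\colon\mathcal{C}\to\mathcal{D}$ and $R\colon\mathcal{D}\to\mathcal{C}$ such that the projection formula holds for $R$. Assume that $\mathcal{C}$ has reflexive coequalizers and that these are preserved by the tensor product of $\mathcal{C}$ in both components. Let $T=RG$ and let $\mathbf{EM}(T)$ be its Eilenberg--Moore category with its monoidal structure. Then: (1) The Eilenberg--Moore adjunction $\mathrm{Free}\dashv\mathrm{Forg}$, with $\mathrm{Free}\colon\mathcal{C}\to\mathbf{EM}(T)$ and $\mathrm{Forg}\colon\mathbf{EM}(T)\to\mathcal{C}$, is a monoidal adjunction. (2) The canonical functor $\tilde R\colon\mathcal{D}\to\mathbf{EM}(T)$, $X\mapsto(RX,R(\mathrm{counit}_X))$, is lax monoidal. (3) The projection formula holds for $\mathrm{Forg}$.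
   Context: Conventions: monoidal categories are written as if strict. A lax monoidal functor $F$ has structure maps $\mathrm{lax}^F_{X,Y}\colon FX\otimes FY\to F(X\otimes Y)$, $\mathrm{lax}^F_0\colon\mathbb{1}\to F\mathbb{1}$. A monoidal adjunction is an adjunction with both functors lax monoidal and unit, counit monoidal transformations (then the left adjoint is strong monoidal). Projection formula for $R$: $\mathrm{lproj}_{A,X}=\mathrm{lax}^R_{GA,X}\circ(\mathrm{unit}_A\otimes RX)\colon A\otimes RX\to R(GA\otimes X)$ and $\mathrm{rproj}_{X,A}=\mathrm{lax}^R_{X,GA}\circ(RX\otimes\mathrm{unit}_A)\colon RX\otimes A\to R(X\otimes GA)$ are isomorphisms for all $A\in\mathcal{C}$, $X\in\mathcal{D}$; similarly for the right adjoint $\mathrm{Forg}$ of the monoidal adjunction $\mathrm{Free}\dashv\mathrm{Forg}$. A reflexive coequalizer is a coequalizer of a parallel pair $f,g\colon A\to B$ admitting $s\colon B\to A$ with $fs=gs=\mathrm{id}_B$. Monoidal structure on $\mathbf{EM}(T)$: set $M=R(\mathbb{1})$, a monoid in $\mathcal{C}$ via $\mathrm{lax}^R_0$ and $\mathrm{lax}^R_{\mathbb{1},\mathbb{1}}$, with half-braiding $\mathrm{swap}_A=(\mathrm{lproj}_{A,\mathbb{1}})^{-1}\circ\mathrm{rproj}_{\mathbb{1},A}\colon M\otimes A\to A\otimes M$; this makes $M$ a commutative monoid in the Drinfeld center $\mathcal{Z}(\mathcal{C})$. The isomorphism $\mathrm{lproj}_{-,\mathbb{1}}\colon(-)\otimes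 M\to T$ of monads identifies $\mathbf{EM}(T)$ with the category $\mathbf{Mod}_{\mathcal{C}}\text{-}M$ of right $M$-modules $(A,\mathrm{act}^A\colon A\otimes M\to A)$ in $\mathcal{C}$. For right $M$-modules $X=(A,\mathrm{act}^A)$, $Y=(B,\mathrm{act}^B)$, the tensor product $\mathrm{quo}_{X,Y}\colon A\otimes B\to X\otimes_MY$ is the (reflexive) coequalizer in $\mathcal{C}$ of $\mathrm{act}^A\otimes B$ and $A\otimes(\mathrm{act}^B\circ\mathrm{swap}_B)\colon A\otimes M\otimes B\to A\otimes B$, with $M$-action induced by $A\otimes\mathrm{act}^B$; the unit object is $M$. This is a monoidal category. $\mathrm{Free}(A)=A\otimes M$ with action $A\otimes\mathrm{mul}^M$ (equivalently $TA$ with action $\mathrm{mul}^T_A$), and $\mathrm{Forg}$ forgets the action. The map $\mathrm{lax}^{\mathrm{Free}}_{A,B}\colon\mathrm{Free}(A)\otimes_M\mathrm{Free}(B)\to\mathrm{Free}(A\otimes B)$ is the factorization through $\mathrm{quo}$ of $(A\otimes B\otimes\mathrm{mul}^M)(A\otimes\mathrm{swap}_B\otimes M)$, and $\mathrm{lax}^{\mathrm{Forg}}_{X,Y}=\mathrm{quo}_{X,Y}$. *)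

(* Defs.v *)
From Stdlib Require Import ssreflect ProofIrrelevance IndefiniteDescription.

Set Implicit Arguments.
Unset Strict Implicit.
Unset Printing Implicit Defensive.

Declare Scope cat_scope.
Delimit Scope cat_scope with cat.
Local Open Scope cat_scope.

Record Category : Type := {
  ob :> Type;
  hom : ob -> ob -> Type;
  idm : forall A, hom A A;
  comp : forall A B C, hom B C -> hom A B -> hom A C;
  comp_idl : forall A B (f : hom A B), comp (idm B) f = f;
  comp_idr : forall A B (f : hom A B), comp f (idm A) = f;
  comp_assoc : forall A B C D (f : hom C D) (g : hom B C) (h : hom A B),
    comp (comp f g) h = comp f (comp g h) }.

Arguments hom {_} _ _.
Arguments idm {_} _.
Arguments comp {_ _ _ _} _ _.
Notation "f ∘ g" := (comp f g) (at level 40, left associativity) : cat_scope.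

Definition is_inverse (C : Category) (A B : C) (f : hom A B) (g : hom B A) : Prop :=
  g ∘ f = idm A /\ f ∘ g = idm B.

Definition is_iso (C : Category) (A B : C) (f : hom A B) : Prop :=
  exists g, is_inverse f g.

Definition inverse (C : Category) (A B : C) (f : hom A B) (i : is_iso f) : hom B A :=
  proj1_sig (constructive_indefinite_description _ i).

Record Functor (C D : Category) : Type := {
  fob :> C -> D;
  fmap : forall A B, hom A B -> hom (fob A) (fob B);
  fmap_id : forall A, fmap (idm A) = idm (fob A);
  fmap_comp : forall A B E (f : hom B E) (g : hom A B),
    fmap (f ∘ g) = fmap f ∘ fmap g }.

Arguments fmap {C D} F {A B} f : rename.

Definition functor_id (C : Category) : Functor C C :=
  {| fob := fun A => A; fmap := fun A B f => f;
     fmap_id := fun A => eq_refl; fmap_comp := fun A B E f g => eq_refl |}.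

Program Definition functor_comp (C D E : Category) (G : Functor D E) (F : Functor C D) :
    Functor C E :=
  {| fob := fun A => G (F A); fmap := fun A B f => fmap G (fmap F f) |}.
Next Obligation. by rewrite !fmap_id. Qed.
Next Obligation. by rewrite !fmap_comp. Qed.

Definition is_natural (C D : Category) (F G : Functor C D)
    (t : forall A, hom (F A) (G A)) : Prop :=
  forall A B (f : hom A B), t B ∘ fmap F f = fmap G f ∘ t A.

Record Adjunction (C D : Category) (G : Functor C D) (R : Functor D C) : Type := {
  unit : forall A : C, hom A (R (G A));
  counit : forall X : D, hom (G (R X)) X;
  unit_natural : is_natural (F := functor_id C) (G := functor_comp R G) unit;
  counit_natural : is_natural (F := functor_comp G R) (G := functor_id D) counit;
  triangle_left : forall A, counit (G A) ∘ fmap G (unit A) = idm (G A);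
  triangle_right : forall X, fmap R (counit X) ∘ unit (R X) = idm (R X) }.

Definition is_coequalizer (C : Category) (A B Q : C) (f g : hom A B) (q : hom B Q) : Prop :=
  q ∘ f = q ∘ g /\
  forall (Z : C) (h : hom B Z), h ∘ f = h ∘ g -> exists! k : hom Q Z, k ∘ q = h.

Definition is_reflexive_pair (C : Category) (A B : C) (f g : hom A B) : Prop :=
  exists s : hom B A, f ∘ s = idm B /\ g ∘ s = idm B.

Definition has_reflexive_coequalizers (C : Category) : Prop :=
  forall (A B : C) (f g : hom A B), is_reflexive_pair f g ->
  exists (Q : C) (q : hom B Q), is_coequalizer f g q.

Class Monoidal (C : Category) : Type := {
  tens : C -> C -> C;
  munit : C;
  tensm : forall A A' B B' : C, hom A A' -> hom B B' -> hom (tens A B) (tens A' B');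
  tensm_id : forall A B : C, tensm (idm A) (idm B) = idm (tens A B);
  tensm_comp : forall (A A' A'' B B' B'' : C) (f' : hom A' A'') (f : hom A A')
      (g' : hom B' B'') (g : hom B B'),
    tensm (f' ∘ f) (g' ∘ g) = tensm f' g' ∘ tensm f g;
  assoc : forall A B E : C, hom (tens (tens A B) E) (tens A (tens B E));
  assoc_inv : forall A B E : C, hom (tens A (tens B E)) (tens (tens A B) E);
  lunit : forall A : C, hom (tens munit A) A;
  lunit_inv : forall A : C, hom A (tens munit A);
  runit : forall A : C, hom (tens A munit) A;
  runit_inv : forall A : C, hom A (tens A munit);
  assoc_iso : forall A B E : C, is_inverse (assoc A B E) (assoc_inv A B E);
  lunit_iso : forall A : C, is_inverse (lunit A) (lunit_inv A);
  runit_iso : forall A : C, is_inverse (runit A) (runit_inv A);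
  assoc_natural : forall (A A' B B' E E' : C) (f : hom A A') (g : hom B B') (h : hom E E'),
    assoc A' B' E' ∘ tensm (tensm f g) h = tensm f (tensm g h) ∘ assoc A B E;
  lunit_natural : forall (A A' : C) (f : hom A A'),
    lunit A' ∘ tensm (idm munit) f = f ∘ lunit A;
  runit_natural : forall (A A' : C) (f : hom A A'),
    runit A' ∘ tensm f (idm munit) = f ∘ runit A;
  pentagon : forall A B E F : C,
    assoc A B (tens E F) ∘ assoc (tens A B) E F =
    tensm (idm A) (assoc B E F) ∘ (assoc A (tens B E) F ∘ tensm (assoc A B E) (idm F));
  triangle : forall A B : C,
    tensm (idm A) (lunit B) ∘ assoc A munit B = tensm (runit A) (idm B) }.

Notation "A ⊗ B" := (tens A B) (at level 39, left associativity) : cat_scope.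
Notation "f ⊗₁ g" := (tensm f g) (at level 39, left associativity) : cat_scope.
Notation "𝟙" := munit : cat_scope.
Notation "A ◁ f" := (tensm (idm A) f) (at level 39, left associativity) : cat_scope.
Notation "f ▷ A" := (tensm f (idm A)) (at level 39, left associativity) : cat_scope.

Definition tensor_preserves_reflexive_coequalizers (C : Category) (MC : Monoidal C) : Prop :=
  forall (A B Q : C) (f g : hom A B) (q : hom B Q),
    is_reflexive_pair f g -> is_coequalizer f g q ->
    forall Z : C, is_coequalizer (f ▷ Z) (g ▷ Z) (q ▷ Z) /\
                  is_coequalizer (Z ◁ f) (Z ◁ g) (Z ◁ q).

Record LaxMonoidal (C D : Category) (MC : Monoidal C) (MD : Monoidal D)
    (F : Functor C D) : Type := {
  lax : forall A B : C, hom (F A ⊗ F B) (F (A ⊗ B));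
  lax0 : hom 𝟙 (F 𝟙);
  lax_natural : forall (A A' B B' : C) (f : hom A A') (g : hom B B'),
    lax A' B' ∘ (fmap F f ⊗₁ fmap F g) = fmap F (f ⊗₁ g) ∘ lax A B;
  lax_assoc : forall A B E : C,
    fmap F (assoc A B E) ∘ (lax (A ⊗ B) E ∘ (lax A B ▷ F E)) =
    lax A (B ⊗ E) ∘ ((F A ◁ lax B E) ∘ assoc (F A) (F B) (F E));
  lax_lunit : forall A : C,
    fmap F (lunit A) ∘ (lax 𝟙 A ∘ (lax0 ▷ F A)) = lunit (F A);
  lax_runit : forall A : C,
    fmap F (runit A) ∘ (lax A 𝟙 ∘ (F A ◁ lax0)) = runit (F A) }.

Arguments LaxMonoidal {C D} {MC MD} F.

Program Definition lax_id (C : Category) (MC : Monoidal C) : LaxMonoidal (functor_id C) :=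
  {| lax := fun A B => idm (A ⊗ B); lax0 := idm 𝟙 |}.
Next Obligation. by rewrite comp_idl comp_idr. Qed.
Next Obligation. by rewrite !tensm_id !comp_idl !comp_idr. Qed.
Next Obligation. by rewrite !tensm_id !comp_idr. Qed.
Next Obligation. by rewrite !tensm_id !comp_idr. Qed.

Lemma tens_compl (C : Category) (MC : Monoidal C) (A B B' B'' : C)
  (f : hom B' B'') (g : hom B B') : A ◁ (f ∘ g) = (A ◁ f) ∘ (A ◁ g).
Proof. by rewrite -tensm_comp comp_idl. Qed.

Lemma tens_compr (C : Category) (MC : Monoidal C) (A B B' B'' : C)
  (f : hom B' B'') (g : hom B B') : (f ∘ g) ▷ A = (f ▷ A) ∘ (g ▷ A).
Proof. by rewrite -tensm_comp comp_idl. Qed.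

Lemma post (C : Category) (A B B' E : C) (f : hom B E) (g : hom A B)
    (f' : hom B' E) (g' : hom A B') :
  f ∘ g = f' ∘ g' -> forall Z (h : hom Z A), f ∘ (g ∘ h) = f' ∘ (g' ∘ h).
Proof. by move=> e Z h; rewrite -!comp_assoc e. Qed.

Lemma post1 (C : Category) (A B E : C) (f : hom B E) (g : hom A B) (k : hom A E) :
  f ∘ g = k -> forall Z (h : hom Z A), f ∘ (g ∘ h) = k ∘ h.
Proof. by move=> e Z h; rewrite -!comp_assoc e. Qed.

Lemma fmap_post (C D : Category) (F : Functor C D) (A B E : C) (f : hom B E) (g : hom A B)
    (Z : D) (h : hom Z (F A)) :
  fmap F f ∘ (fmap F g ∘ h) = fmap F (f ∘ g) ∘ h.
Proof. by rewrite fmap_comp comp_assoc. Qed.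

Lemma lax_naturall (C D : Category) (MC : Monoidal C) (MD : Monoidal D) (F : Functor C D)
    (lF : LaxMonoidal F) (A A' B : C) (f : hom A A') :
  lax lF A' B ∘ (fmap F f ▷ F B) = fmap F (f ▷ B) ∘ lax lF A B.
Proof. by rewrite -lax_natural fmap_id. Qed.

Lemma lax_naturalr (C D : Category) (MC : Monoidal C) (MD : Monoidal D) (F : Functor C D)
    (lF : LaxMonoidal F) (A B B' : C) (f : hom B B') :
  lax lF A B' ∘ (F A ◁ fmap F f) = fmap F (A ◁ f) ∘ lax lF A B.
Proof. by rewrite -lax_natural fmap_id. Qed.

Program Definition lax_comp (C D E : Category) (MC : Monoidal C) (MD : Monoidal D)
    (ME : Monoidal E) (G : Functor D E) (F : Functor C D)
    (lG : LaxMonoidal G) (lF : LaxMonoidal F) : LaxMonoidal (functor_comp G F) :=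
  {| lax := fun A B => fmap G (lax lF A B) ∘ lax lG (F A) (F B);
     lax0 := fmap G (lax0 lF) ∘ lax0 lG |}.
Next Obligation.
by rewrite comp_assoc lax_natural fmap_post -comp_assoc -fmap_comp lax_natural.
Qed.
Next Obligation.
rewrite tens_compr tens_compl !comp_assoc (post (lax_naturall lG _ _)).
rewrite !fmap_post !comp_assoc lax_assoc !fmap_comp !comp_assoc lax_assoc.
by rewrite (post (lax_naturalr lG _ _)).
Qed.
Next Obligation.
by rewrite tens_compr !comp_assoc (post (lax_naturall lG _ _)) !fmap_post !comp_assoc !lax_lunit.
Qed.
Next Obligation.
by rewrite tens_compl !comp_assoc (post (lax_naturalr lG _ _)) !fmap_post !comp_assoc !lax_runit.
Qed.

Record is_monoidal_transformation (C D : Category) (MC : Monoidal C) (MD : Monoidal D)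
    (F G : Functor C D) (lF : LaxMonoidal F) (lG : LaxMonoidal G)
    (t : forall A, hom (F A) (G A)) : Prop := {
  mt_natural : is_natural t;
  mt_lax : forall A B : C, t (A ⊗ B) ∘ lax lF A B = lax lG A B ∘ (t A ⊗₁ t B);
  mt_lax0 : t 𝟙 ∘ lax0 lF = lax0 lG }.

Record is_monoidal_adjunction (C D : Category) (MC : Monoidal C) (MD : Monoidal D)
    (G : Functor C D) (R : Functor D C) (adj : Adjunction G R)
    (lG : LaxMonoidal G) (lR : LaxMonoidal R) : Prop := {
  unit_monoidal : is_monoidal_transformation (lax_id MC) (lax_comp lR lG) (unit adj);
  counit_monoidal : is_monoidal_transformation (lax_comp lG lR) (lax_id MD) (counit adj) }.

Definition lproj (C D : Category) (MC : Monoidal C) (MD : Monoidal D)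
    (G : Functor C D) (R : Functor D C) (adj : Adjunction G R) (lR : LaxMonoidal R)
    (A : C) (X : D) : hom (A ⊗ R X) (R (G A ⊗ X)) :=
  lax lR (G A) X ∘ (unit adj A ▷ R X).

Definition rproj (C D : Category) (MC : Monoidal C) (MD : Monoidal D)
    (G : Functor C D) (R : Functor D C) (adj : Adjunction G R) (lR : LaxMonoidal R)
    (X : D) (A : C) : hom (R X ⊗ A) (R (X ⊗ G A)) :=
  lax lR X (G A) ∘ (R X ◁ unit adj A).

Record projection_formula (C D : Category) (MC : Monoidal C) (MD : Monoidal D)
    (G : Functor C D) (R : Functor D C) (adj : Adjunction G R) (lR : LaxMonoidal R) : Prop := {
  lproj_iso : forall (A : C) (X : D), is_iso (lproj adj lR A X);
  rproj_iso : forall (X : D) (A : C), is_iso (rproj adj lR X A) }.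

Record Monad (C : Category) : Type := {
  mfun :> Functor C C;
  eta : forall A, hom A (mfun A);
  mu : forall A, hom (mfun (mfun A)) (mfun A);
  eta_natural : is_natural (F := functor_id C) (G := mfun) eta;
  mu_natural : is_natural (F := functor_comp mfun mfun) (G := mfun) mu;
  mu_etal : forall A, mu A ∘ eta (mfun A) = idm (mfun A);
  mu_etar : forall A, mu A ∘ fmap mfun (eta A) = idm (mfun A);
  mu_mu : forall A, mu A ∘ fmap mfun (mu A) = mu A ∘ mu (mfun A) }.

Program Definition adj_monad (C D : Category) (G : Functor C D) (R : Functor D C)
    (adj : Adjunction G R) : Monad C :=
  {| mfun := functor_comp R G;
     eta := unit adj;
     mu := fun A => fmap R (counit adj (G A)) |}.
Next Obligation. exact: unit_natural. Qed.
Next Obligation.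
by move=> A B f /=; rewrite -!fmap_comp; congr (fmap R _); apply: counit_natural.
Qed.
Next Obligation. exact: triangle_right. Qed.
Next Obligation. by rewrite -fmap_comp triangle_left fmap_id. Qed.
Next Obligation.
by rewrite -!fmap_comp; congr (fmap R _); apply: counit_natural.
Qed.

Section EilenbergMoore.
Context (C : Category) (T : Monad C).

Record Algebra : Type := {
  carrier :> C;
  alg : hom (T carrier) carrier;
  alg_eta : alg ∘ eta T carrier = idm carrier;
  alg_mu : alg ∘ fmap T alg = alg ∘ mu T carrier }.

Record AlgebraHom (X Y : Algebra) : Type := {
  under : hom (carrier X) (carrier Y);
  under_alg : under ∘ alg X = alg Y ∘ fmap T under }.

Lemma AlgebraHom_eq X Y (f g : AlgebraHom X Y) : under f = under g -> f = g.
Proof.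
by case: f g => [f ef] [g eg] /= e; subst g; rewrite (proof_irrelevance _ ef eg).
Qed.

Program Definition EM : Category :=
  {| ob := Algebra;
     hom := AlgebraHom;
     idm := fun X => {| under := idm (carrier X) |};
     comp := fun X Y Z f g => {| under := under f ∘ under g |} |}.
Next Obligation. by rewrite fmap_id comp_idl comp_idr. Qed.
Next Obligation. by rewrite comp_assoc under_alg fmap_comp -!comp_assoc under_alg. Qed.
Next Obligation. by apply: AlgebraHom_eq; rewrite /= comp_idl. Qed.
Next Obligation. by apply: AlgebraHom_eq; rewrite /= comp_idr. Qed.
Next Obligation. by apply: AlgebraHom_eq; rewrite /= comp_assoc. Qed.

Definition Forg : Functor EM C :=
  {| fob := (carrier : EM -> C);
     fmap := (under : forall X Y : EM, hom X Y -> hom (carrier X) (carrier Y));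
     fmap_id := fun X => eq_refl; fmap_comp := fun X Y Z f g => eq_refl |}.

Program Definition Free : Functor C EM :=
  {| fob := fun A : C => ({| carrier := T A; alg := mu T A |} : EM);
     fmap := fun A B f => {| under := fmap T f |} |}.
Next Obligation. exact: mu_etal. Qed.
Next Obligation. exact: mu_mu. Qed.
Next Obligation. by rewrite (mu_natural T f). Qed.
Next Obligation. by apply: AlgebraHom_eq; rewrite /= fmap_id. Qed.
Next Obligation. by apply: AlgebraHom_eq; rewrite /= fmap_comp. Qed.

Program Definition EM_adj : Adjunction Free Forg :=
  {| unit := eta T;
     counit := fun X : EM => ({| under := alg X |} : hom (Free (Forg X)) X) |}.
Next Obligation. by rewrite alg_mu. Qed.
Next Obligation. exact: eta_natural. Qed.
Next Obligation.
by move=> X Y f; apply: AlgebraHom_eq; rewrite /= under_alg.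
Qed.
Next Obligation. by apply: AlgebraHom_eq; rewrite /= mu_etar. Qed.
Next Obligation. exact: alg_eta. Qed.

End EilenbergMoore.

Arguments carrier {C T} _.
Arguments alg {C T} _.
Arguments under {C T X Y} _.

Program Definition comparison (C D : Category) (G : Functor C D) (R : Functor D C)
    (adj : Adjunction G R) : Functor D (EM (adj_monad adj)) :=
  {| fob := fun X : D =>
       ({| carrier := R X; alg := fmap R (counit adj X) |} : EM (adj_monad adj));
     fmap := fun X Y f => {| under := fmap R f |} |}.
Next Obligation. exact: triangle_right. Qed.
Next Obligation.
by rewrite -!fmap_comp; congr (fmap R _); apply: counit_natural.
Qed.
Next Obligation.
by rewrite -!fmap_comp; congr (fmap R _); rewrite (counit_natural adj f).
Qed.
Next Obligation. by apply: AlgebraHom_eq; rewrite /= fmap_id. Qed.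
Next Obligation. by apply: AlgebraHom_eq; rewrite /= fmap_comp. Qed.

Section RelativeTensor.
Context (C D : Category) (MC : Monoidal C) (MD : Monoidal D).
Context (G : Functor C D) (R : Functor D C) (adj : Adjunction G R).
Context (lR : LaxMonoidal R) (pf : projection_formula adj lR).

Local Notation T := (adj_monad adj).
Local Notation M := (R 𝟙).

Definition mulM : hom (M ⊗ M) M := fmap R (lunit 𝟙) ∘ lax lR 𝟙 𝟙.

(** [lprojM A] is [lproj A 𝟙] followed by the identification of [R (G A ⊗ 𝟙)] with
    [T A = R (G A)]; similarly for [rprojM]. *)
Definition lprojM (A : C) : hom (A ⊗ M) (T A) := fmap R (runit (G A)) ∘ lproj adj lR A 𝟙.
Definition rprojM (A : C) : hom (M ⊗ A) (T A) := fmap R (lunit (G A)) ∘ rproj adj lR 𝟙 A.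

Definition swap (A : C) : hom (M ⊗ A) (A ⊗ M) :=
  inverse (lproj_iso pf A 𝟙) ∘
    (fmap R (runit_inv (G A)) ∘ (fmap R (lunit (G A)) ∘ rproj adj lR 𝟙 A)).

(** The right [M]-action on a [T]-algebra under the isomorphism of monads
    [lprojM : (-) ⊗ M -> T]. *)
Definition act (X : EM T) : hom (carrier X ⊗ M) (carrier X) := alg X ∘ lprojM (carrier X).

Definition balance_l (X Y : EM T) : hom (carrier X ⊗ M ⊗ carrier Y) (carrier X ⊗ carrier Y) :=
  act X ▷ carrier Y.
Definition balance_r (X Y : EM T) : hom (carrier X ⊗ M ⊗ carrier Y) (carrier X ⊗ carrier Y) :=
  (carrier X ◁ (act Y ∘ swap (carrier Y))) ∘ assoc (carrier X) M (carrier Y).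

(** A monoidal structure on [EM T] is the tensor product over [M] when its tensor
    product, with maps [quo], is given by coequalizers of [balance_l] and [balance_r]
    with the action induced from the right factor, its unit is the regular module [M],
    and its coherence isomorphisms are the ones induced by those of [C].  Coequalizers
    and the unit object are only determined up to isomorphism, so no choice of them is
    fixed: [quo] and [unitM] are part of the structure.  Everything else is determined by
    the equations below when the tensor product preserves these coequalizers, since [quo]
    is then an epimorphism also after tensoring. *)
Record EM_monoidal : Type := {
  EM_mon :> Monoidal (EM T);
  quo : forall X Y : EM T, hom (carrier X ⊗ carrier Y) (carrier (X ⊗ Y));
  quo_coequalizer : forall X Y : EM T,
    is_coequalizer (balance_l X Y) (balance_r X Y) (quo X Y);
  quo_act : forall X Y : EM T,
    act (X ⊗ Y) ∘ (quo X Y ▷ M) =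
    quo X Y ∘ ((carrier X ◁ act Y) ∘ assoc (carrier X) (carrier Y) M);
  quo_tensm : forall (X X' Y Y' : EM T) (f : hom X X') (g : hom Y Y'),
    under (f ⊗₁ g) ∘ quo X Y = quo X' Y' ∘ (under f ⊗₁ under g);
  unitM : hom M (carrier (𝟙 : EM T));
  unitM_iso : is_iso unitM;
  unitM_act : act 𝟙 ∘ (unitM ▷ M) = unitM ∘ mulM;
  quo_assoc : forall X Y Z : EM T,
    under (assoc X Y Z) ∘ (quo (X ⊗ Y) Z ∘ (quo X Y ▷ carrier Z)) =
    quo X (Y ⊗ Z) ∘ ((carrier X ◁ quo Y Z) ∘ assoc (carrier X) (carrier Y) (carrier Z));
  quo_lunit : forall Y : EM T,
    under (lunit Y) ∘ (quo 𝟙 Y ∘ (unitM ▷ carrier Y)) = act Y ∘ swap (carrier Y);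
  quo_runit : forall X : EM T,
    under (runit X) ∘ (quo X 𝟙 ∘ (carrier X ◁ unitM)) = act X }.

(** [A ⊗ M ⊗ B ⊗ M -> A ⊗ B ⊗ M], i.e. [(A ⊗ B ⊗ mulM) ∘ (A ⊗ swap_B ⊗ M)]. *)
Definition free_tensor (A B : C) : hom ((A ⊗ M) ⊗ (B ⊗ M)) ((A ⊗ B) ⊗ M) :=
  ((A ⊗ B) ◁ mulM) ∘
  (assoc_inv A B (M ⊗ M) ∘
  ((A ◁ assoc B M M) ∘
  ((A ◁ (swap B ▷ M)) ∘
  ((A ◁ assoc_inv M B M) ∘
  assoc A M (B ⊗ M))))).

Context (V : EM_monoidal).

(** The structure maps of [Free], stated through the isomorphisms [lprojM] between
    [A ⊗ M] and [T A]. *)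
Definition is_lax_Free (lG : LaxMonoidal G) (lF : LaxMonoidal (MD := V) (Free T)) : Prop :=
  (forall A B : C,
    under (lax lF A B) ∘ (quo V (Free T A) (Free T B) ∘ (lprojM A ⊗₁ lprojM B)) =
    lprojM (A ⊗ B) ∘ free_tensor A B) /\
  under (lax0 lF) ∘ unitM V = fmap R (lax0 lG).

Definition is_lax_Forg (lU : LaxMonoidal (MC := V) (Forg T)) : Prop :=
  (forall X Y : EM T, lax lU X Y = quo V X Y) /\
  lax0 lU = unitM V ∘ lax0 lR.

Definition is_lax_comparison (lK : LaxMonoidal (MD := V) (comparison adj)) : Prop :=
  (forall X Y : D,
    under (lax lK X Y) ∘ quo V (comparison adj X) (comparison adj Y) = lax lR X Y) /\
  under (lax0 lK) ∘ unitM V = idm M.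

End RelativeTensor.

Module TensorExistence.

(* Purely syntactic reassociation: rewriting with [comp_assoc] also unfolds constants that
   are themselves composites. *)
Ltac asc := repeat match goal with
  |- context [comp (comp ?f ?g) ?h] => rewrite (comp_assoc f g h) end.

Section MonoidalLemmas.
Context (C : Category) {MC : Monoidal C}.

Lemma iso_mono (A B Z : C) (f : hom A B) g (x y : hom Z A) :
  is_inverse f g -> f ∘ x = f ∘ y -> x = y.
Proof.
by case=> e _ h; rewrite -(comp_idl x) -(comp_idl y) -e !comp_assoc h.
Qed.

Lemma iso_epi (A B Z : C) (f : hom A B) g (x y : hom B Z) :
  is_inverse f g -> x ∘ f = y ∘ f -> x = y.
Proof.
by case=> _ e h; rewrite -(comp_idr x) -(comp_idr y) -e -!comp_assoc h.
Qed.

Lemma exch (A A' B B' : C) (f : hom A A') (g : hom B B') :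
  (f ▷ B') ∘ (A ◁ g) = (A' ◁ g) ∘ (f ▷ B).
Proof. by rewrite -!tensm_comp !comp_idl !comp_idr. Qed.

Lemma tensm_lr (A A' B B' : C) (f : hom A A') (g : hom B B') :
  f ⊗₁ g = (f ▷ B') ∘ (A ◁ g).
Proof. by rewrite -!tensm_comp !comp_idl !comp_idr. Qed.

Lemma tensm_rl (A A' B B' : C) (f : hom A A') (g : hom B B') :
  f ⊗₁ g = (A' ◁ g) ∘ (f ▷ B).
Proof. by rewrite -!tensm_comp !comp_idl !comp_idr. Qed.

Lemma nat1 (A A' B E : C) (f : hom A A') :
  assoc A' B E ∘ (f ▷ B ▷ E) = (f ▷ (B ⊗ E)) ∘ assoc A B E.
Proof. by rewrite assoc_natural tensm_id. Qed.

Lemma nat2 (A B B' E : C) (f : hom B B') :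
  assoc A B' E ∘ ((A ◁ f) ▷ E) = (A ◁ (f ▷ E)) ∘ assoc A B E.
Proof. by rewrite assoc_natural. Qed.

Lemma nat3 (A B E E' : C) (f : hom E E') :
  assoc A B E' ∘ ((A ⊗ B) ◁ f) = (A ◁ (B ◁ f)) ∘ assoc A B E.
Proof. by rewrite -assoc_natural tensm_id. Qed.

Lemma assocK (A B E : C) : assoc_inv A B E ∘ assoc A B E = idm _.
Proof. by case: (assoc_iso A B E). Qed.

Lemma assocKV (A B E : C) : assoc A B E ∘ assoc_inv A B E = idm _.
Proof. by case: (assoc_iso A B E). Qed.

Lemma assocK_post (A B E Z : C) (h : hom Z _) :
  assoc_inv A B E ∘ (assoc A B E ∘ h) = h.
Proof. by rewrite -comp_assoc assocK comp_idl. Qed.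

Lemma assocKV_post (A B E Z : C) (h : hom Z _) :
  assoc A B E ∘ (assoc_inv A B E ∘ h) = h.
Proof. by rewrite -comp_assoc assocKV comp_idl. Qed.

Lemma inverse_whiskerl (A B Z : C) (f : hom A B) g :
  is_inverse f g -> is_inverse (Z ◁ f) (Z ◁ g).
Proof. by case=> e e'; split; rewrite -tens_compl ?e ?e' tensm_id. Qed.

Lemma inverse_whiskerr (A B Z : C) (f : hom A B) g :
  is_inverse f g -> is_inverse (f ▷ Z) (g ▷ Z).
Proof. by case=> e e'; split; rewrite -tens_compr ?e ?e' tensm_id. Qed.

Lemma whisker1_injr (A B : C) (f g : hom A B) : f ▷ 𝟙 = g ▷ 𝟙 -> f = g.
Proof.
move=> h; apply: (iso_epi (runit_iso A)).
by rewrite -!runit_natural h.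
Qed.

Lemma whisker1_injl (A B : C) (f g : hom A B) : 𝟙 ◁ f = 𝟙 ◁ g -> f = g.
Proof.
move=> h; apply: (iso_epi (lunit_iso A)).
by rewrite -!lunit_natural h.
Qed.

Lemma runit_tens (A B : C) : (A ◁ runit B) ∘ assoc A B 𝟙 = runit (A ⊗ B).
Proof.
apply: whisker1_injr; apply: (iso_mono (assoc_iso A B 𝟙)).
rewrite tens_compr (post (nat2 _ _ _)) -triangle tens_compl comp_assoc -pentagon.
by rewrite -(triangle (A ⊗ B)) -(post (nat3 _ _ _)).
Qed.

Lemma lunit_tens (A B : C) : lunit (A ⊗ B) ∘ assoc 𝟙 A B = lunit A ▷ B.
Proof.
apply: whisker1_injl.
apply: (iso_epi (assoc_iso 𝟙 (𝟙 ⊗ A) B)).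
apply: (iso_epi (inverse_whiskerr B (assoc_iso 𝟙 𝟙 A))).
rewrite tens_compl !comp_assoc -pentagon (post1 (triangle _ _)) -nat1.
by rewrite -triangle tens_compr (post (nat2 _ _ _)).
Qed.

Lemma lunit_runit1 : lunit 𝟙 = runit (𝟙 : C).
Proof.
apply: whisker1_injr; rewrite -triangle -lunit_tens; congr (_ ∘ _).
apply: (iso_mono (lunit_iso 𝟙)); by rewrite lunit_natural.
Qed.

End MonoidalLemmas.

Section MonoidLemmas.
Context (C D : Category) (MC : Monoidal C) (MD : Monoidal D).
Context (G : Functor C D) (R : Functor D C) (adj : Adjunction G R).
Context (lG : LaxMonoidal G) (lR : LaxMonoidal R).
Context (Hadj : is_monoidal_adjunction adj lG lR) (pf : projection_formula adj lR).

Local Notation T := (adj_monad adj).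
Local Notation M := (R 𝟙).
Local Notation u := (unit adj).
Local Notation lp := (lprojM adj lR).
Local Notation rp := (rprojM adj lR).
Local Notation sw := (swap pf).
Local Notation mul := (mulM lR).
Local Notation etaM := (lax0 lR).

Lemma inverseP (E : Category) (A B : E) (f : hom A B) (i : is_iso f) :
  is_inverse f (inverse i).
Proof. exact: proj2_sig. Qed.

Lemma fmap_inverse (E F : Category) (K : Functor E F) (A B : E) (f : hom A B) g :
  is_inverse f g -> is_inverse (fmap K f) (fmap K g).
Proof. by case=> e e'; split; rewrite -fmap_comp ?e ?e' fmap_id. Qed.

Lemma inverse_comp (E : Category) (A B Z : E) (f : hom B Z) f' (g : hom A B) g' :
  is_inverse f f' -> is_inverse g g' -> is_inverse (f ∘ g) (g' ∘ f').
Proof.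
move=> [e1 e2] [e3 e4]; split; rewrite comp_assoc.
  by rewrite -(comp_assoc f') e1 comp_idl.
by rewrite -(comp_assoc g) e4 comp_idl.
Qed.

Definition lprojM_inv (A : C) : hom (T A) (A ⊗ M) :=
  inverse (lproj_iso pf A 𝟙) ∘ fmap R (runit_inv (G A)).

Lemma lprojM_iso A : is_inverse (lp A) (lprojM_inv A).
Proof.
apply: inverse_comp; first by apply: fmap_inverse; apply: runit_iso.
exact: inverseP.
Qed.

Lemma lprojM_swap A : lp A ∘ sw A = rp A.
Proof.
have -> : sw A = lprojM_inv A ∘ rp A by rewrite /swap /lprojM_inv comp_assoc.
by rewrite -comp_assoc (proj2 (lprojM_iso A)) comp_idl.
Qed.

Lemma unitE (A B : C) (f : hom A B) : u B ∘ f = fmap R (fmap G f) ∘ u A.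
Proof. exact: (unit_natural adj f). Qed.

Lemma lprojM_natural A B (f : hom A B) : lp B ∘ (f ▷ M) = fmap R (fmap G f) ∘ lp A.
Proof.
rewrite /lprojM /lproj !comp_assoc -tens_compr unitE tens_compr.
by rewrite (post (lax_naturall lR _ _)) [in LHS]fmap_post runit_natural fmap_comp !comp_assoc.
Qed.

Lemma rprojM_natural A B (f : hom A B) : rp B ∘ (M ◁ f) = fmap R (fmap G f) ∘ rp A.
Proof.
rewrite /rprojM /rproj !comp_assoc -tens_compl unitE tens_compl.
by rewrite (post (lax_naturalr lR _ _)) [in LHS]fmap_post lunit_natural fmap_comp !comp_assoc.
Qed.

Lemma swap_natural A B (f : hom A B) : sw B ∘ (M ◁ f) = (f ▷ M) ∘ sw A.
Proof.
apply: (iso_mono (lprojM_iso B)).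
rewrite (post1 (lprojM_swap _)) (post (lprojM_natural _)) rprojM_natural.
by rewrite lprojM_swap.
Qed.

Lemma unit_tens A B :
  u (A ⊗ B) = fmap R (lax lG A B) ∘ (lax lR (G A) (G B) ∘ (u A ⊗₁ u B)).
Proof.
have /= := mt_lax (unit_monoidal Hadj) A B.
by rewrite comp_idr comp_assoc.
Qed.

Lemma lprojM_tens A B :
  lp (A ⊗ B) =
  fmap R (lax lG A B) ∘ (lax lR (G A) (G B) ∘ ((u A ⊗₁ lp B) ∘ assoc A B M)).
Proof.
rewrite {1}/lprojM /lproj unit_tens !tens_compr (post (lax_naturall lR _ _)).
rewrite [in LHS]fmap_post runit_natural fmap_comp !comp_assoc; congr (_ ∘ _).
rewrite -runit_tens fmap_comp comp_assoc.
rewrite -(comp_assoc (lax lR (_ ⊗ _) _)) -(comp_assoc (fmap R (assoc _ _ _))).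
rewrite lax_assoc !comp_assoc.
rewrite -(post (lax_naturalr lR _ _)) assoc_natural; congr (_ ∘ _).
by rewrite -!comp_assoc -!tensm_comp !comp_idl /lprojM /lproj ?comp_assoc.
Qed.

Lemma rprojM_tens A B :
  rp (A ⊗ B) ∘ assoc M A B =
  fmap R (lax lG A B) ∘ (lax lR (G A) (G B) ∘ (rp A ⊗₁ u B)).
Proof.
rewrite {1}/rprojM /rproj unit_tens !tens_compl ?comp_assoc (post (lax_naturalr lR _ _)).
rewrite [in LHS]fmap_post lunit_natural fmap_comp !comp_assoc; congr (_ ∘ _).
rewrite -assoc_natural.
rewrite -(comp_assoc (M ◁ _)) -(comp_assoc (lax lR _ (_ ⊗ _))) -lax_assoc !comp_assoc.
rewrite [in LHS]fmap_post lunit_tens -(post (lax_naturall lR _ _)); congr (_ ∘ _).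
by rewrite -!tensm_comp !comp_idl /rprojM /rproj ?comp_assoc.
Qed.

Lemma proj_mid A B :
  lax lR (G A) (G B) ∘ ((u A ⊗₁ rp B) ∘ assoc A M B) =
  lax lR (G A) (G B) ∘ (lp A ⊗₁ u B).
Proof.
have -> : u A ⊗₁ rp B = (R (G A) ◁ fmap R (lunit (G B))) ∘
    ((R (G A) ◁ lax lR 𝟙 (G B)) ∘ (u A ⊗₁ (M ◁ u B))).
  by rewrite -!tensm_comp !comp_idl /rprojM /rproj.
rewrite !comp_assoc -assoc_natural (post (lax_naturalr lR _ _)).
rewrite -(comp_assoc (_ ◁ lax _ _ _)) -(comp_assoc (lax lR _ (_ ⊗ _))) -lax_assoc.
rewrite !comp_assoc [in LHS]fmap_post triangle -(post (lax_naturall lR _ _)); congr (_ ∘ _).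
by rewrite -!tensm_comp !comp_idl /lprojM /lproj.
Qed.

Lemma swap_tens A B :
  sw (A ⊗ B) ∘ assoc M A B =
  assoc_inv A B M ∘ ((A ◁ sw B) ∘ (assoc A M B ∘ (sw A ▷ B))).
Proof.
apply: (iso_mono (lprojM_iso (A ⊗ B))).
rewrite (post1 (lprojM_swap _)) rprojM_tens lprojM_tens !comp_assoc assocKV_post.
congr (_ ∘ _).
have e : u A ⊗₁ lp B ∘ (A ◁ sw B) = u A ⊗₁ rp B.
  by rewrite -tensm_comp comp_idr lprojM_swap.
rewrite (post1 e) -(comp_assoc (u A ⊗₁ _)) -(comp_assoc (lax _ _ _)) proj_mid comp_assoc.
by rewrite -tensm_comp comp_idr lprojM_swap.
Qed.

Lemma lprojM_eta A : lp A ∘ (A ◁ etaM) = u A ∘ runit A.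
Proof.
rewrite /lprojM /lproj !comp_assoc exch -(comp_assoc (lax _ _ _)).
by rewrite -(comp_assoc (fmap R _)) lax_runit runit_natural.
Qed.

Lemma rprojM_eta A : rp A ∘ (etaM ▷ A) = u A ∘ lunit A.
Proof.
rewrite /rprojM /rproj !comp_assoc -exch -(comp_assoc (lax _ _ _)).
by rewrite -(comp_assoc (fmap R _)) lax_lunit lunit_natural.
Qed.

Lemma counit_lprojM X :
  fmap R (counit adj X) ∘ lp (R X) = fmap R (runit X) ∘ lax lR X 𝟙.
Proof.
rewrite /lprojM /lproj [in LHS]fmap_post -runit_natural fmap_comp comp_assoc.
by rewrite -(post (lax_naturall lR _ _)) -tens_compr triangle_right tensm_id comp_idr.
Qed.

Lemma counit_rprojM X :
  fmap R (counit adj X) ∘ rp (R X) = fmap R (lunit X) ∘ lax lR 𝟙 X.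
Proof.
rewrite /rprojM /rproj [in LHS]fmap_post -lunit_natural fmap_comp comp_assoc.
by rewrite -(post (lax_naturalr lR _ _)) -tens_compl triangle_right tensm_id comp_idr.
Qed.

Lemma mulM_swap : mul ∘ sw M = mul.
Proof.
rewrite {1}/mulM lunit_runit1 -counit_lprojM comp_assoc lprojM_swap.
by rewrite counit_rprojM.
Qed.

Lemma lprojM_mul B :
  fmap R (runit (G B)) ∘ (lax lR (G B) 𝟙 ∘ (lp B ▷ M)) =
  lp B ∘ ((B ◁ mul) ∘ assoc B M M).
Proof.
rewrite {1}/lprojM /lproj !tens_compr (post (lax_naturall lR _ _)).
rewrite -triangle fmap_comp comp_assoc -(comp_assoc (lax lR (_ ⊗ _) _)).
rewrite -(comp_assoc (fmap R (assoc _ _ _))) lax_assoc !comp_assoc nat1.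
rewrite -(post (lax_naturalr lR _ _)) -(comp_assoc (_ ◁ _)) -tens_compl -/mul.
by rewrite /lprojM /lproj ?comp_assoc (post (exch _ _)).
Qed.

Lemma rprojM_mul B :
  fmap R (lunit (G B)) ∘ (lax lR 𝟙 (G B) ∘ ((M ◁ rp B) ∘ assoc M M B)) =
  rp B ∘ (mul ▷ B).
Proof.
rewrite {1}/rprojM /rproj !tens_compl !comp_assoc (post (lax_naturalr lR _ _)).
rewrite -nat3 -(comp_assoc (_ ◁ lax _ _ _)) -(comp_assoc (lax lR _ (_ ⊗ _))) -lax_assoc.
rewrite !comp_assoc (fmap_post (_ ◁ _)) triangle -lunit_runit1 -(post (lax_naturall lR _ _)).
rewrite -(comp_assoc (_ ▷ _)) -tens_compr -/mul.
by rewrite /rprojM /rproj ?comp_assoc -exch.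
Qed.

Lemma projM_bi B :
  fmap R (runit (G B)) ∘ (lax lR (G B) 𝟙 ∘ (rp B ▷ M)) =
  fmap R (lunit (G B)) ∘ (lax lR 𝟙 (G B) ∘ ((M ◁ lp B) ∘ assoc M B M)).
Proof.
rewrite /rprojM /rproj !tens_compr (post (lax_naturall lR _ _)).
rewrite -lunit_tens fmap_comp !comp_assoc -(comp_assoc (lax lR (_ ⊗ _) _)).
rewrite -(comp_assoc (fmap R (assoc _ _ _))) lax_assoc !comp_assoc nat2.
rewrite [in LHS]fmap_post -lunit_natural fmap_comp comp_assoc -(post (lax_naturalr lR _ _)).
by rewrite /lprojM /lproj !tens_compl ?comp_assoc.
Qed.

Local Notation ac := (act lR).
Definition lact (X : EM T) : hom (M ⊗ carrier X) (carrier X) := alg X ∘ rp (carrier X).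

Lemma lactE (X : EM T) : ac X ∘ sw (carrier X) = lact X.
Proof. by rewrite /act comp_assoc lprojM_swap. Qed.

Lemma act_alg (X : EM T) Z (h : hom Z (T (carrier X))) :
  ac X ∘ ((alg X ∘ h) ▷ M) =
  alg X ∘ (fmap R (runit (G (carrier X))) ∘ (lax lR (G (carrier X)) 𝟙 ∘ (h ▷ M))).
Proof.
rewrite /act tens_compr comp_assoc (post (lprojM_natural _)).
rewrite -comp_assoc (alg_mu X) comp_assoc; congr (_ ∘ _).
by rewrite (post (counit_lprojM _)).
Qed.

Lemma lact_alg (X : EM T) Z (h : hom Z (T (carrier X))) :
  lact X ∘ (M ◁ (alg X ∘ h)) =
  alg X ∘ (fmap R (lunit (G (carrier X))) ∘ (lax lR 𝟙 (G (carrier X)) ∘ (M ◁ h))).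
Proof.
rewrite /lact tens_compl comp_assoc (post (rprojM_natural _)).
rewrite -comp_assoc (alg_mu X) comp_assoc; congr (_ ∘ _).
by rewrite (post (counit_rprojM _)).
Qed.

Lemma act_act (X : EM T) :
  ac X ∘ (ac X ▷ M) = ac X ∘ ((carrier X ◁ mul) ∘ assoc (carrier X) M M).
Proof. by rewrite {2}/act act_alg lprojM_mul /act comp_assoc. Qed.

Lemma lact_lact (X : EM T) :
  lact X ∘ ((M ◁ lact X) ∘ assoc M M (carrier X)) = lact X ∘ (mul ▷ carrier X).
Proof.
rewrite -comp_assoc {2}/lact lact_alg ![in LHS]comp_assoc rprojM_mul.
exact: eq_sym (comp_assoc _ _ _).
Qed.

Lemma act_lact (X : EM T) :
  ac X ∘ (lact X ▷ M) = lact X ∘ ((M ◁ ac X) ∘ assoc M (carrier X) M).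
Proof.
rewrite {1}/lact act_alg projM_bi -(comp_assoc (lact _)) /act lact_alg.
by rewrite !comp_assoc.
Qed.

Lemma act_eta (X : EM T) : ac X ∘ (carrier X ◁ etaM) = runit (carrier X).
Proof. by rewrite /act comp_assoc lprojM_eta -comp_assoc (alg_eta X) comp_idl. Qed.

Lemma lact_eta (X : EM T) : lact X ∘ (etaM ▷ carrier X) = lunit (carrier X).
Proof. by rewrite /lact comp_assoc rprojM_eta -comp_assoc (alg_eta X) comp_idl. Qed.

Lemma under_act (X Y : EM T) (f : hom X Y) :
  under f ∘ ac X = ac Y ∘ (under f ▷ M).
Proof.
rewrite /act -(comp_assoc (under f)) (under_alg f) !(comp_assoc (alg Y)); congr (_ ∘ _).
by rewrite lprojM_natural.
Qed.

Lemma act_under (X Y : EM T) (f : hom (carrier X) (carrier Y)) :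
  f ∘ ac X = ac Y ∘ (f ▷ M) -> f ∘ alg X = alg Y ∘ fmap T f.
Proof.
move=> e; apply: (iso_epi (lprojM_iso _)).
by rewrite (comp_assoc f) -[alg X ∘ _]/(ac X) e /act !(comp_assoc (alg Y)) lprojM_natural.
Qed.

Definition EM_hom (X Y : EM T) (f : hom (carrier X) (carrier Y))
  (e : f ∘ ac X = ac Y ∘ (f ▷ M)) : hom X Y := {| under_alg := act_under e |}.

Lemma under_lact (X Y : EM T) (f : hom X Y) :
  under f ∘ lact X = lact Y ∘ (M ◁ under f).
Proof.
rewrite /lact -(comp_assoc (under f)) (under_alg f) !(comp_assoc (alg Y)); congr (_ ∘ _).
by rewrite rprojM_natural.
Qed.

Lemma act_comparison (X : D) : ac (comparison adj X) = fmap R (runit X) ∘ lax lR X 𝟙.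
Proof. exact: counit_lprojM. Qed.

Section AlgebraOfModule.
Context (A : C) (a : hom (A ⊗ M) A).
Context (aM : a ∘ (a ▷ M) = a ∘ ((A ◁ mul) ∘ assoc A M M)).
Context (a1 : a ∘ (A ◁ etaM) = runit A).

Lemma alg_of_mod_eta : (a ∘ lprojM_inv A) ∘ eta T A = idm A.
Proof.
apply: (iso_epi (runit_iso A)).
have e : eta T A ∘ runit A = lp A ∘ (A ◁ etaM) by rewrite lprojM_eta.
rewrite comp_assoc e (comp_assoc a) -(comp_assoc (lprojM_inv A)).
by rewrite (proj1 (lprojM_iso A)) !comp_idl.
Qed.

Lemma alg_of_mod_mu :
  (a ∘ lprojM_inv A) ∘ fmap T (a ∘ lprojM_inv A) = (a ∘ lprojM_inv A) ∘ mu T A.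
Proof.
have [k [-> kl]] : exists k, a ∘ lprojM_inv A = k /\ k ∘ lp A = a.
  by eexists; split; [reflexivity | rewrite comp_assoc (proj1 (lprojM_iso A)) comp_idr].
have e1 : fmap T k ∘ lp (T A) = lp A ∘ (k ▷ M) by rewrite lprojM_natural.
have e2 : mu T A ∘ lp (T A) = fmap R (runit (G A)) ∘ lax lR (G A) 𝟙.
  exact: counit_lprojM.
apply: (iso_epi (lprojM_iso (T A))); apply: (iso_epi (inverse_whiskerr M (lprojM_iso A))).
rewrite !(comp_assoc k) e1 e2 (comp_assoc (lp A)) -tens_compr kl.
rewrite -(comp_assoc k) kl aM (comp_assoc (fmap R _)) lprojM_mul.
by rewrite -(comp_assoc k) kl.
Qed.

Definition alg_of_mod : EM T :=
  {| alg_eta := alg_of_mod_eta; alg_mu := alg_of_mod_mu |}.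

Lemma act_alg_of_mod : ac alg_of_mod = a.
Proof. by rewrite /act /= comp_assoc (proj1 (lprojM_iso A)) comp_idr. Qed.
End AlgebraOfModule.

End MonoidLemmas.

Section Existence.
Context (C D : Category) (MC : Monoidal C) (MD : Monoidal D).
Context (G : Functor C D) (R : Functor D C) (adj : Adjunction G R).
Context (lG : LaxMonoidal G) (lR : LaxMonoidal R).
Context (Hadj : is_monoidal_adjunction adj lG lR) (pf : projection_formula adj lR).
Context (Hcoeq : has_reflexive_coequalizers C).
Context (Htens : tensor_preserves_reflexive_coequalizers MC).

Local Notation T := (adj_monad adj).
Local Notation M := (R 𝟙).
Local Notation sw := (swap pf).
Local Notation mul := (mulM lR).
Local Notation etaM := (lax0 lR).
Local Notation ac := (act lR).
Local Notation la := (lact lR).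
Local Notation U := carrier.

Section Coequalizers.
Context (A B Q : C) (f g : hom A B) (q0 : hom B Q) (c : is_coequalizer f g q0).

Lemma coeq_epi Z (x y : hom Q Z) : x ∘ q0 = y ∘ q0 -> x = y.
Proof.
move=> e; have [k [_ h]] : exists! k : hom Q Z, k ∘ q0 = y ∘ q0.
  by apply: (proj2 c); asc; rewrite (proj1 c).
by rewrite -(h x e) -(h y).
Qed.

Lemma coeq_desc Z (h : hom B Z) : h ∘ f = h ∘ g -> { k : hom Q Z | k ∘ q0 = h }.
Proof.
move=> e; apply: constructive_indefinite_description.
by have [k [e' _]] := proj2 c Z h e; exists k.
Qed.
End Coequalizers.

Lemma reflexive_whisker (A B : C) (f g : hom A B) (Z : C) :
  is_reflexive_pair f g ->
  is_reflexive_pair (f ▷ Z) (g ▷ Z) /\ is_reflexive_pair (Z ◁ f) (Z ◁ g).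
Proof.
case=> s [e e']; split; [exists (s ▷ Z) | exists (Z ◁ s)];
  by rewrite -?tens_compr -?tens_compl e e' tensm_id.
Qed.

Lemma balance_rE (X Y : EM T) :
  balance_r pf X Y = (U X ◁ la Y) ∘ assoc (U X) M (U Y).
Proof. by rewrite /balance_r lactE. Qed.

Lemma balance_reflexive (X Y : EM T) :
  is_reflexive_pair (balance_l lR X Y) (balance_r pf X Y).
Proof.
have [e1 e2] := runit_iso (U X).
exists (((U X ◁ etaM) ▷ U Y) ∘ (runit_inv (U X) ▷ U Y)); split.
  by rewrite /balance_l -!tens_compr -comp_assoc act_eta e2 tensm_id.
rewrite balance_rE comp_assoc (post (nat2 _ _ _)) -(comp_assoc (_ ◁ _)) -tens_compl.
by rewrite lact_eta -comp_assoc triangle -tens_compr e2 tensm_id.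
Qed.

Lemma coequalizer_exists (X Y : EM T) :
  { Q : C & { q0 : hom (U X ⊗ U Y) Q |
      is_coequalizer (balance_l lR X Y) (balance_r pf X Y) q0 } }.
Proof.
have [Q h] := constructive_indefinite_description _ (Hcoeq (balance_reflexive X Y)).
by exists Q; apply: constructive_indefinite_description.
Qed.

Definition Qob (X Y : EM T) : C := projT1 (coequalizer_exists X Y).
Definition q0 (X Y : EM T) : hom (U X ⊗ U Y) (Qob X Y) := proj1_sig (projT2 (coequalizer_exists X Y)).
Lemma q0_coeq (X Y : EM T) : is_coequalizer (balance_l lR X Y) (balance_r pf X Y) (q0 X Y).
Proof. exact: proj2_sig (projT2 (coequalizer_exists X Y)). Qed.

Lemma q0_bal (X Y : EM T) :
  q0 X Y ∘ (ac X ▷ U Y) = q0 X Y ∘ ((U X ◁ la Y) ∘ assoc (U X) M (U Y)).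
Proof. by have [e _] := q0_coeq X Y; rewrite balance_rE in e. Qed.

Lemma q0r_coeq (X Y : EM T) (Z : C) :
  is_coequalizer (balance_l lR X Y ▷ Z) (balance_r pf X Y ▷ Z) (q0 X Y ▷ Z).
Proof. exact: (proj1 (Htens (balance_reflexive X Y) (q0_coeq X Y) Z)). Qed.

Lemma q0l_coeq (X Y : EM T) (Z : C) :
  is_coequalizer (Z ◁ balance_l lR X Y) (Z ◁ balance_r pf X Y) (Z ◁ q0 X Y).
Proof. exact: (proj2 (Htens (balance_reflexive X Y) (q0_coeq X Y) Z)). Qed.

Lemma q0_epi (X Y : EM T) (Z : C) (x y : hom (Qob X Y) Z) : x ∘ q0 X Y = y ∘ q0 X Y -> x = y.
Proof. exact: coeq_epi (q0_coeq X Y) Z x y. Qed.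

Lemma q0r_epi (X Y : EM T) (W Z : C) (x y : hom (Qob X Y ⊗ W) Z) :
  x ∘ (q0 X Y ▷ W) = y ∘ (q0 X Y ▷ W) -> x = y.
Proof. exact: coeq_epi (q0r_coeq X Y W) Z x y. Qed.

Lemma q0l_epi (X Y : EM T) (W Z : C) (x y : hom (W ⊗ Qob X Y) Z) :
  x ∘ (W ◁ q0 X Y) = y ∘ (W ◁ q0 X Y) -> x = y.
Proof. exact: coeq_epi (q0l_coeq X Y W) Z x y. Qed.

Lemma q0rr_epi (X Y : EM T) (W W' Z : C) (x y : hom (Qob X Y ⊗ W ⊗ W') Z) :
  x ∘ (q0 X Y ▷ W ▷ W') = y ∘ (q0 X Y ▷ W ▷ W') -> x = y.
Proof.
have h := proj1 (reflexive_whisker W (balance_reflexive X Y)).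
exact: coeq_epi (proj1 (Htens h (q0r_coeq X Y W) W')) Z x y.
Qed.

Lemma q0_desc (X Y : EM T) (Z : C) (h : hom (U X ⊗ U Y) Z) :
  h ∘ (ac X ▷ U Y) = h ∘ ((U X ◁ la Y) ∘ assoc (U X) M (U Y)) ->
  { k : hom (Qob X Y) Z | k ∘ q0 X Y = h }.
Proof. by move=> e; apply: (coeq_desc (q0_coeq X Y)); rewrite balance_rE. Qed.

Lemma q0r_desc (X Y : EM T) (W Z : C) (h : hom (U X ⊗ U Y ⊗ W) Z) :
  h ∘ (ac X ▷ U Y ▷ W) = h ∘ (((U X ◁ la Y) ∘ assoc (U X) M (U Y)) ▷ W) ->
  { k : hom (Qob X Y ⊗ W) Z | k ∘ (q0 X Y ▷ W) = h }.
Proof. by move=> e; apply: (coeq_desc (q0r_coeq X Y W)); rewrite balance_rE. Qed.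

Lemma q0l_desc (X Y : EM T) (W Z : C) (h : hom (W ⊗ (U X ⊗ U Y)) Z) :
  h ∘ (W ◁ (ac X ▷ U Y)) = h ∘ (W ◁ ((U X ◁ la Y) ∘ assoc (U X) M (U Y))) ->
  { k : hom (W ⊗ Qob X Y) Z | k ∘ (W ◁ q0 X Y) = h }.
Proof. by move=> e; apply: (coeq_desc (q0l_coeq X Y W)); rewrite balance_rE. Qed.

Lemma Qact_sig (X Y : EM T) : { a : hom (Qob X Y ⊗ M) (Qob X Y) |
  a ∘ (q0 X Y ▷ M) = q0 X Y ∘ ((U X ◁ ac Y) ∘ assoc (U X) (U Y) M) }.
Proof.
apply: q0r_desc.
asc; rewrite nat1 -(post (exch _ _)) (post (q0_bal _ _)); asc.
rewrite (post (nat3 _ _ _)) pentagon tens_compr (post (nat2 _ _ _)).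
congr (_ ∘ _); rewrite -!(comp_assoc (_ ◁ _)) -!tens_compl.
rewrite act_lact !tens_compl; by asc.
Qed.

Definition Qact (X Y : EM T) := proj1_sig (Qact_sig X Y).
Lemma QactE (X Y : EM T) :
  Qact X Y ∘ (q0 X Y ▷ M) = q0 X Y ∘ ((U X ◁ ac Y) ∘ assoc (U X) (U Y) M).
Proof. exact: proj2_sig (Qact_sig X Y). Qed.

Lemma Qact_mul (X Y : EM T) :
  Qact X Y ∘ (Qact X Y ▷ M) = Qact X Y ∘ ((Qob X Y ◁ mul) ∘ assoc (Qob X Y) M M).
Proof.
apply: q0rr_epi.
asc; rewrite nat1 -tens_compr QactE !tens_compr.
rewrite -(post (exch _ _)) !(post (QactE _ _)); asc.
rewrite (post (nat3 _ _ _)) (post (nat2 _ _ _)) pentagon; congr (_ ∘ _).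
rewrite -!(comp_assoc (_ ◁ _)) -!tens_compl.
rewrite act_act !tens_compl; by asc.
Qed.

Lemma Qact_eta (X Y : EM T) : Qact X Y ∘ (Qob X Y ◁ etaM) = runit (Qob X Y).
Proof.
apply: q0r_epi; rewrite comp_assoc -exch (post (QactE _ _)); asc; rewrite nat3.
by rewrite -(comp_assoc (_ ◁ _)) -tens_compl act_eta runit_tens runit_natural.
Qed.

Definition Qalg (X Y : EM T) : EM T := alg_of_mod pf (Qact_mul X Y) (Qact_eta X Y).

Definition q (X Y : EM T) : hom (U X ⊗ U Y) (U (Qalg X Y)) := q0 X Y.

Lemma q_coeq (X Y : EM T) : is_coequalizer (balance_l lR X Y) (balance_r pf X Y) (q X Y).
Proof. exact: q0_coeq. Qed.

Lemma q_bal (X Y : EM T) :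
  q X Y ∘ (ac X ▷ U Y) = q X Y ∘ ((U X ◁ la Y) ∘ assoc (U X) M (U Y)).
Proof. exact: q0_bal. Qed.

Lemma q_epi (X Y : EM T) (Z : C) (x y : hom (U (Qalg X Y)) Z) : x ∘ q X Y = y ∘ q X Y -> x = y.
Proof. exact: q0_epi. Qed.

Lemma qr_epi (X Y : EM T) (W Z : C) (x y : hom (U (Qalg X Y) ⊗ W) Z) :
  x ∘ (q X Y ▷ W) = y ∘ (q X Y ▷ W) -> x = y.
Proof. exact: q0r_epi. Qed.

Lemma ql_epi (X Y : EM T) (W Z : C) (x y : hom (W ⊗ U (Qalg X Y)) Z) :
  x ∘ (W ◁ q X Y) = y ∘ (W ◁ q X Y) -> x = y.
Proof. exact: q0l_epi. Qed.

Lemma qrr_epi (X Y : EM T) (W W' Z : C) (x y : hom (U (Qalg X Y) ⊗ W ⊗ W') Z) :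
  x ∘ (q X Y ▷ W ▷ W') = y ∘ (q X Y ▷ W ▷ W') -> x = y.
Proof. exact: q0rr_epi. Qed.

Lemma q_desc (X Y : EM T) (Z : C) (h : hom (U X ⊗ U Y) Z) :
  h ∘ (ac X ▷ U Y) = h ∘ ((U X ◁ la Y) ∘ assoc (U X) M (U Y)) ->
  { k : hom (U (Qalg X Y)) Z | k ∘ q X Y = h }.
Proof. exact: q0_desc. Qed.

Lemma qr_desc (X Y : EM T) (W Z : C) (h : hom (U X ⊗ U Y ⊗ W) Z) :
  h ∘ (ac X ▷ U Y ▷ W) = h ∘ (((U X ◁ la Y) ∘ assoc (U X) M (U Y)) ▷ W) ->
  { k : hom (U (Qalg X Y) ⊗ W) Z | k ∘ (q X Y ▷ W) = h }.
Proof. exact: q0r_desc. Qed.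

Lemma ql_desc (X Y : EM T) (W Z : C) (h : hom (W ⊗ (U X ⊗ U Y)) Z) :
  h ∘ (W ◁ (ac X ▷ U Y)) = h ∘ (W ◁ ((U X ◁ la Y) ∘ assoc (U X) M (U Y))) ->
  { k : hom (W ⊗ U (Qalg X Y)) Z | k ∘ (W ◁ q X Y) = h }.
Proof. exact: q0l_desc. Qed.

Lemma act_Qalg (X Y : EM T) : ac (Qalg X Y) = Qact X Y.
Proof. exact: act_alg_of_mod. Qed.

Lemma acQ (X Y : EM T) :
  ac (Qalg X Y) ∘ (q X Y ▷ M) = q X Y ∘ ((U X ◁ ac Y) ∘ assoc (U X) (U Y) M).
Proof. by rewrite act_Qalg; exact: QactE. Qed.

Lemma laQ (X Y : EM T) :
  la (Qalg X Y) ∘ ((M ◁ q X Y) ∘ assoc M (U X) (U Y)) = q X Y ∘ (la X ▷ U Y).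
Proof.
rewrite -(lactE pf) comp_assoc (post (swap_natural pf (q X Y))) (post (acQ _ _)).
rewrite (swap_tens Hadj); asc; rewrite assocKV_post -(comp_assoc (_ ◁ _)) -tens_compl lactE.
by rewrite -(comp_assoc (_ ◁ _)) -(post (q_bal X Y)) -tens_compr lactE.
Qed.

Lemma Qmor_sig (X X' Y Y' : EM T) (f : hom X X') (g : hom Y Y') :
  { k : hom (U (Qalg X Y)) (U (Qalg X' Y')) | k ∘ q X Y = q X' Y' ∘ (under f ⊗₁ under g) }.
Proof.
apply: q_desc.
asc; rewrite -tensm_comp comp_idr (under_act lR f).
rewrite -{1}(comp_idl (under g)) tensm_comp (post (q_bal _ _)); asc; rewrite assoc_natural.
by rewrite -!(comp_assoc (_ ⊗₁ _)) -!tensm_comp comp_idl comp_idr (under_lact lR g).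
Qed.

Lemma Qmor_act (X X' Y Y' : EM T) (f : hom X X') (g : hom Y Y') k :
  k ∘ q X Y = q X' Y' ∘ (under f ⊗₁ under g) ->
  k ∘ ac (Qalg X Y) = ac (Qalg X' Y') ∘ (k ▷ M).
Proof.
move=> e; apply: (qr_epi (X := X) (Y := Y)).
asc; rewrite -tens_compr e tens_compr (post (acQ _ _)) acQ.
rewrite (post e); asc; rewrite assoc_natural; congr (_ ∘ _).
rewrite -!(comp_assoc (_ ⊗₁ _)) -!tensm_comp comp_idl comp_idr.
by rewrite (under_act lR g).
Qed.

Definition Qmor (X X' Y Y' : EM T) (f : hom X X') (g : hom Y Y') : hom (Qalg X Y) (Qalg X' Y') :=
  EM_hom pf (Qmor_act (proj2_sig (Qmor_sig f g))).

Lemma QmorE (X X' Y Y' : EM T) (f : hom X X') (g : hom Y Y') :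
  under (Qmor f g) ∘ q X Y = q X' Y' ∘ (under f ⊗₁ under g).
Proof. exact: proj2_sig (Qmor_sig f g). Qed.

Lemma Qassoc1_sig (X Y Z : EM T) : { k : hom (U (Qalg X Y) ⊗ U Z) (U (Qalg X (Qalg Y Z))) |
  k ∘ (q X Y ▷ U Z) = q X (Qalg Y Z) ∘ ((U X ◁ q Y Z) ∘ assoc (U X) (U Y) (U Z)) }.
Proof.
apply: qr_desc.
asc; rewrite nat1 -(post (exch _ _)) (post (q_bal _ _)); asc.
rewrite (post (nat3 _ _ _)) pentagon tens_compr (post (nat2 _ _ _)); congr (_ ∘ _).
rewrite -!(comp_assoc (_ ◁ _)) -!tens_compl.
rewrite -laQ !tens_compl; by asc.
Qed.

Lemma Qassoc_sig (X Y Z : EM T) : { k : hom (U (Qalg (Qalg X Y) Z)) (U (Qalg X (Qalg Y Z))) |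
  k ∘ (q (Qalg X Y) Z ∘ (q X Y ▷ U Z)) =
  q X (Qalg Y Z) ∘ ((U X ◁ q Y Z) ∘ assoc (U X) (U Y) (U Z)) }.
Proof.
have [k1 e1] := Qassoc1_sig X Y Z.
have [|k e] := q_desc (X := Qalg X Y) (Y := Z) (h := k1).
  apply: qrr_epi.
  asc; rewrite nat1 -(post (exch _ _)) (post e1) -tens_compr acQ !tens_compr.
  rewrite (post e1); asc; rewrite (post (nat3 _ _ _)) pentagon (post (nat2 _ _ _)).
  congr (_ ∘ _); rewrite -!(comp_assoc (_ ◁ _)) -!tens_compl.
  rewrite q_bal !tens_compl; by asc.
by exists k; rewrite (post1 e).
Qed.

Lemma Qassoc_act (X Y Z : EM T) (k : hom (U (Qalg (Qalg X Y) Z)) (U (Qalg X (Qalg Y Z)))) :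
  k ∘ (q (Qalg X Y) Z ∘ (q X Y ▷ U Z)) =
  q X (Qalg Y Z) ∘ ((U X ◁ q Y Z) ∘ assoc (U X) (U Y) (U Z)) ->
  k ∘ ac (Qalg (Qalg X Y) Z) = ac (Qalg X (Qalg Y Z)) ∘ (k ▷ M).
Proof.
move=> e; apply: (qr_epi (X := Qalg X Y) (Y := Z)); apply: qrr_epi.
asc; rewrite -!tens_compr e !tens_compr (post (acQ _ _)) (post (acQ _ _)).
asc; rewrite nat1 -(post (exch _ _)) -(comp_assoc (q _ _)) (post e); asc.
rewrite (post (nat3 _ _ _)) pentagon (post (nat2 _ _ _)); congr (_ ∘ _).
rewrite -!(comp_assoc (_ ◁ _)) -!tens_compl.
rewrite acQ !tens_compl; by asc.
Qed.

Definition Qassoc (X Y Z : EM T) : hom (Qalg (Qalg X Y) Z) (Qalg X (Qalg Y Z)) :=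
  EM_hom pf (Qassoc_act (proj2_sig (Qassoc_sig X Y Z))).

Lemma QassocE (X Y Z : EM T) :
  under (Qassoc X Y Z) ∘ (q (Qalg X Y) Z ∘ (q X Y ▷ U Z)) =
  q X (Qalg Y Z) ∘ ((U X ◁ q Y Z) ∘ assoc (U X) (U Y) (U Z)).
Proof. exact: proj2_sig (Qassoc_sig X Y Z). Qed.

Lemma QassocE_post (X Y Z : EM T) (W : C) (h : hom W (U X ⊗ U Y ⊗ U Z)) :
  under (Qassoc X Y Z) ∘ (q (Qalg X Y) Z ∘ ((q X Y ▷ U Z) ∘ h)) =
  q X (Qalg Y Z) ∘ ((U X ◁ q Y Z) ∘ (assoc (U X) (U Y) (U Z) ∘ h)).
Proof. by rewrite -(comp_assoc (q _ _)) (post (QassocE _ _ _)); asc. Qed.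

Lemma Qassoc_inv_sig (X Y Z : EM T) : { k : hom (U (Qalg X (Qalg Y Z))) (U (Qalg (Qalg X Y) Z)) |
  k ∘ (q X (Qalg Y Z) ∘ ((U X ◁ q Y Z) ∘ assoc (U X) (U Y) (U Z))) =
  q (Qalg X Y) Z ∘ (q X Y ▷ U Z) }.
Proof.
pose k' := q (Qalg X Y) Z ∘ ((q X Y ▷ U Z) ∘ assoc_inv (U X) (U Y) (U Z)).
have e' : k' ∘ assoc (U X) (U Y) (U Z) = q (Qalg X Y) Z ∘ (q X Y ▷ U Z).
  rewrite /k'; asc; by rewrite assocK comp_idr.
have [|k1 e1] := ql_desc (X := Y) (Y := Z) (W := U X) (h := k').
  apply: (iso_epi (assoc_iso _ _ _)).
  apply: (iso_epi (inverse_whiskerr _ (assoc_iso _ _ _))).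
  move: k' e' => k' e'.
  asc; rewrite -(post (nat2 _ _ _)) (post e'); asc; rewrite -!tens_compr.
  rewrite -acQ tens_compr (post (q_bal _ _)); asc; rewrite nat1 -(post (exch _ _)).
  rewrite -(post e') (post (nat3 _ _ _)) pentagon.
  rewrite !tens_compl; by asc.
move: k' e' e1 => k' e' e1.
have [|k e] := q_desc (X := X) (Y := Qalg Y Z) (h := k1).
  apply: ql_epi; apply: (iso_epi (assoc_iso _ _ _)).
  asc; rewrite (post (exch _ _)) (post1 e1) -nat1 (post e'); asc.
  rewrite -tens_compr q_bal !tens_compr.
  rewrite (post (nat3 _ _ _)) pentagon -(comp_assoc (U X ◁ _)) -tens_compl.
  rewrite -(comp_assoc (U X ◁ _)) -tens_compl; asc; rewrite laQ tens_compl; asc.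
  rewrite (post1 e1) -(post (nat2 _ _ _)) (post e'); by asc.
by exists k; rewrite (post1 e) (post1 e1) e'.
Qed.

Section EM_inverse.
Context (X Y : EM T) (f : hom X Y) (g : hom (U Y) (U X)) (i : is_inverse (under f) g).

Lemma EM_inv_act : g ∘ ac Y = ac X ∘ (g ▷ M).
Proof.
apply: (iso_epi (inverse_whiskerr M i)).
asc; rewrite -(under_act lR f) -tens_compr (proj1 i) tensm_id comp_idr.
by rewrite -comp_assoc (proj1 i) comp_idl.
Qed.

Definition EM_inv : hom Y X := EM_hom pf EM_inv_act.

Lemma EM_invP : is_inverse f EM_inv.
Proof. by case: i => e e'; split; apply: AlgebraHom_eq. Qed.
End EM_inverse.

Lemma Qassoc_inverse (X Y Z : EM T) :
  is_inverse (under (Qassoc X Y Z)) (proj1_sig (Qassoc_inv_sig X Y Z)).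
Proof.
case: (Qassoc_inv_sig X Y Z) => k /= e; split.
  apply: q_epi; apply: qr_epi; asc; rewrite QassocE e.
  by rewrite comp_idl.
apply: q_epi; apply: ql_epi; apply: (iso_epi (assoc_iso _ _ _)).
asc; by rewrite e QassocE comp_idl.
Qed.

Definition Qunit : EM T := comparison adj 𝟙.

Lemma acU : ac Qunit = mul.
Proof. by rewrite act_comparison -lunit_runit1. Qed.

Lemma laU : la Qunit = mul.
Proof. exact: counit_rprojM. Qed.

Lemma Qlunit_sig (Y : EM T) : { k : hom (U (Qalg Qunit Y)) (U Y) | k ∘ q Qunit Y = la Y }.
Proof. by apply: q_desc; rewrite acU lact_lact. Qed.

Lemma Qlunit_act (Y : EM T) (k : hom (U (Qalg Qunit Y)) (U Y)) :
  k ∘ q Qunit Y = la Y -> k ∘ ac (Qalg Qunit Y) = ac Y ∘ (k ▷ M).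
Proof.
move=> e; apply: (qr_epi (X := Qunit) (Y := Y)).
asc; by rewrite acQ (post1 e) -tens_compr e act_lact.
Qed.

Definition Qlunit (Y : EM T) : hom (Qalg Qunit Y) Y := EM_hom pf (Qlunit_act (proj2_sig (Qlunit_sig Y))).
Lemma QlunitE (Y : EM T) : under (Qlunit Y) ∘ q Qunit Y = la Y.
Proof. exact: proj2_sig (Qlunit_sig Y). Qed.

Lemma Qlunit_inverse (Y : EM T) :
  is_inverse (under (Qlunit Y)) (q Qunit Y ∘ ((etaM ▷ U Y) ∘ lunit_inv (U Y))).
Proof.
have [e1 e2] := lunit_iso (U Y); split; last first.
  by rewrite (post1 (QlunitE _)) -comp_assoc lact_eta.
apply: q_epi; rewrite comp_assoc QlunitE comp_idl; apply: (iso_epi (lunit_iso _)).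
have e : lunit_inv (U Y) ∘ (la Y ∘ lunit (M ⊗ U Y)) = 𝟙 ◁ la Y.
  by rewrite -lunit_natural -comp_assoc e1 comp_idl.
asc; rewrite e exch.
apply: (iso_epi (assoc_iso _ _ _)).
asc; rewrite -nat1 -(comp_assoc (_ ◁ la _)) -(post (q_bal Qunit Y)) acU lunit_tens -tens_compr -laU.
by rewrite lact_eta.
Qed.

Lemma Qrunit_sig (X : EM T) : { k : hom (U (Qalg X Qunit)) (U X) | k ∘ q X Qunit = ac X }.
Proof. by apply: q_desc; rewrite laU act_act. Qed.

Lemma Qrunit_act (X : EM T) (k : hom (U (Qalg X Qunit)) (U X)) :
  k ∘ q X Qunit = ac X -> k ∘ ac (Qalg X Qunit) = ac X ∘ (k ▷ M).
Proof.
move=> e; apply: (qr_epi (X := X) (Y := Qunit)).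
asc; by rewrite acQ (post1 e) -tens_compr e act_act acU.
Qed.

Definition Qrunit (X : EM T) : hom (Qalg X Qunit) X := EM_hom pf (Qrunit_act (proj2_sig (Qrunit_sig X))).
Lemma QrunitE (X : EM T) : under (Qrunit X) ∘ q X Qunit = ac X.
Proof. exact: proj2_sig (Qrunit_sig X). Qed.

Lemma Qrunit_inverse (X : EM T) :
  is_inverse (under (Qrunit X)) (q X Qunit ∘ ((U X ◁ etaM) ∘ runit_inv (U X))).
Proof.
have [e1 e2] := runit_iso (U X); split; last first.
  by rewrite (post1 (QrunitE _)) -comp_assoc act_eta.
apply: q_epi; rewrite comp_assoc QrunitE comp_idl; apply: (iso_epi (runit_iso _)).
have e : runit_inv (U X) ∘ (ac X ∘ runit (U X ⊗ M)) = ac X ▷ 𝟙.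
  by rewrite -runit_natural -comp_assoc e1 comp_idl.
asc; rewrite e -exch (post (q_bal X Qunit)) laU; asc; rewrite nat3.
rewrite -(comp_assoc (_ ◁ _)) -tens_compl -runit_tens.
by rewrite -acU act_eta.
Qed.

Lemma QmorEl (X X' Y Y' : EM T) (Z Z' : C) (f : hom X X') (g : hom Y Y') (h : hom Z Z') :
  (under (Qmor f g) ⊗₁ h) ∘ (q X Y ▷ Z) = (q X' Y' ▷ Z') ∘ ((under f ⊗₁ under g) ⊗₁ h).
Proof. by rewrite -!tensm_comp QmorE comp_idl comp_idr. Qed.

Lemma QmorEr (X X' Y Y' : EM T) (Z Z' : C) (f : hom X X') (g : hom Y Y') (h : hom Z Z') :
  (h ⊗₁ under (Qmor f g)) ∘ (Z ◁ q X Y) = (Z' ◁ q X' Y') ∘ (h ⊗₁ (under f ⊗₁ under g)).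
Proof. by rewrite -!tensm_comp QmorE comp_idl comp_idr. Qed.

Lemma Qassoc_natural (X X' Y Y' Z Z' : EM T) (f : hom X X') (g : hom Y Y') (h : hom Z Z') :
  under (Qassoc X' Y' Z') ∘ under (Qmor (Qmor f g) h) =
  under (Qmor f (Qmor g h)) ∘ under (Qassoc X Y Z).
Proof.
apply: q_epi; apply: qr_epi.
asc; rewrite (post (QmorE _ _)) QmorEl QassocE_post QassocE.
rewrite (post (QmorE _ _)); asc; by rewrite (post (QmorEr _ _ _)) assoc_natural.
Qed.

Lemma Qpentagon (X Y Z W : EM T) :
  under (Qassoc X Y (Qalg Z W)) ∘ under (Qassoc (Qalg X Y) Z W) =
  under (Qmor (idm X) (Qassoc Y Z W)) ∘
    (under (Qassoc X (Qalg Y Z) W) ∘ under (Qmor (Qassoc X Y Z) (idm W))).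
Proof.
apply: q_epi; apply: qr_epi; apply: qrr_epi.
asc; rewrite QassocE_post; asc; rewrite nat1 -(post (exch _ _)).
rewrite QassocE_post; asc; rewrite (post (nat3 _ _ _)) pentagon.
rewrite (post (QmorE _ _)) -!tens_compr QassocE !tens_compr.
rewrite QassocE_post; asc; rewrite (post (nat2 _ _ _)).
rewrite (post (QmorE _ _)); asc; rewrite -!(comp_assoc (U X ◁ _)) -!tens_compl.
asc; rewrite QassocE !tens_compl; by asc.
Qed.

Lemma Qtriangle (X Y : EM T) :
  under (Qmor (idm X) (Qlunit Y)) ∘ under (Qassoc X Qunit Y) =
  under (Qmor (Qrunit X) (idm Y)).
Proof.
apply: q_epi; apply: qr_epi.
asc; rewrite QassocE !(post (QmorE _ _)); asc.
rewrite -tens_compr QrunitE -(comp_assoc (_ ◁ _)) -tens_compl QlunitE.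
by rewrite -(q_bal X Y).
Qed.

Definition EM_Monoidal : Monoidal (EM T).
Proof.
refine {| tens := Qalg; munit := Qunit; tensm := Qmor;
  assoc := Qassoc; assoc_inv := fun X Y Z => EM_inv (Qassoc_inverse X Y Z);
  lunit := Qlunit; lunit_inv := fun Y => EM_inv (Qlunit_inverse Y);
  runit := Qrunit; runit_inv := fun X => EM_inv (Qrunit_inverse X) |}.
- move=> X Y; apply: AlgebraHom_eq; apply: q_epi.
  by rewrite QmorE /= tensm_id comp_idl comp_idr.
- move=> X X' X'' Y Y' Y'' f' f g' g; apply: AlgebraHom_eq; apply: q_epi.
  change (under (Qmor (f' ∘ f) (g' ∘ g)) ∘ q X Y =
    under (Qmor f' g') ∘ under (Qmor f g) ∘ q X Y).
  by rewrite QmorE comp_assoc QmorE (post (QmorE _ _)) -tensm_comp.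
- by move=> X Y Z; apply: EM_invP.
- by move=> Y; apply: EM_invP.
- by move=> X; apply: EM_invP.
- by move=> X X' Y Y' Z Z' f g h; apply: AlgebraHom_eq; apply: Qassoc_natural.
- move=> Y Y' f; apply: AlgebraHom_eq; apply: q_epi.
  change (under (Qlunit Y') ∘ under (Qmor (idm Qunit) f) ∘ q Qunit Y =
    under f ∘ under (Qlunit Y) ∘ q Qunit Y).
  asc; by rewrite QmorE QlunitE (post1 (QlunitE _)) (under_lact lR f).
- move=> X X' f; apply: AlgebraHom_eq; apply: q_epi.
  change (under (Qrunit X') ∘ under (Qmor f (idm Qunit)) ∘ q X Qunit =
    under f ∘ under (Qrunit X) ∘ q X Qunit).
  asc; by rewrite QmorE QrunitE (post1 (QrunitE _)) (under_act lR f).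
- by move=> X Y Z W; apply: AlgebraHom_eq; apply: Qpentagon.
- by move=> X Y; apply: AlgebraHom_eq; apply: Qtriangle.
Defined.

Theorem EM_monoidal_exists : inhabited (EM_monoidal pf).
Proof.
constructor.
refine (@Build_EM_monoidal _ _ _ _ _ _ _ _ pf EM_Monoidal q q_coeq acQ _ (idm M) _ _ _ _ _).
- by move=> X X' Y Y' f g; apply: QmorE.
- by exists (idm M); split; rewrite comp_idl.
- by rewrite tensm_id comp_idl comp_idr; apply: acU.
- by move=> X Y Z; apply: QassocE.
- by move=> Y; rewrite tensm_id comp_idr lactE; apply: QlunitE.
- by move=> X; rewrite tensm_id comp_idr; apply: QrunitE.
Qed.

End Existence.

End TensorExistence.

(** The quantification over [EM_monoidal] is not vacuous: the tensor product over [M] does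
    form a monoidal structure. *)
Theorem EM_monoidal_exists (C D : Category) (MC : Monoidal C) (MD : Monoidal D)
    (G : Functor C D) (R : Functor D C) (adj : Adjunction G R)
    (lG : LaxMonoidal G) (lR : LaxMonoidal R)
    (Hadj : is_monoidal_adjunction adj lG lR) (pf : projection_formula adj lR)
    (Hcoeq : has_reflexive_coequalizers C)
    (Htens : tensor_preserves_reflexive_coequalizers MC) :
  inhabited (EM_monoidal pf).
Proof. exact: (TensorExistence.EM_monoidal_exists Hadj pf Hcoeq Htens). Qed.

(* Main.v *)
(* A [T]-algebra map out of a tensor product over [M] is a balanced, right [M]-linear map out
   of the tensor product in C.  The laxity maps of [R] and of [T = R G] are such maps, so
   they descend along [quo]; the coherence laws of the descended maps are those of [R] and
   [T], since [quo] and its whiskerings are epimorphisms.  The unit of [Free ⊣ Forg] is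
   then monoidal because that of [G ⊣ R] is.  The inverse of the projection morphism
   [A ⊗ X -> Free A ⊗_M X] descends from the action of [M] on [X], applied to
   [TA ⊗ X ≅ A ⊗ M ⊗ X]. *)

Require Import Defs.
From Stdlib Require Import ssreflect.
Import TensorExistence.
Local Open Scope cat_scope.

Set Implicit Arguments.
Unset Strict Implicit.
Unset Printing Implicit Defensive.

Section EilenbergMooreMonoidalAdjunction.
Context (C D : Category) (MC : Monoidal C) (MD : Monoidal D).
Context (G : Functor C D) (R : Functor D C) (adj : Adjunction G R).
Context (lG : LaxMonoidal G) (lR : LaxMonoidal R).
Context (Hadj : is_monoidal_adjunction adj lG lR) (pf : projection_formula adj lR).
Context (Htens : tensor_preserves_reflexive_coequalizers MC).
Context (V : EM_monoidal pf).

Local Notation T := (adj_monad adj).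
Local Notation M := (R 𝟙).
Local Notation U := carrier.
Local Notation K := (comparison adj).
Local Notation sw := (swap pf).
Local Notation lp := (lprojM adj lR).
Local Notation rp := (rprojM adj lR).
Local Notation mul := (mulM lR).
Local Notation etaM := (lax0 lR).
Local Notation ac := (act lR).
Local Notation la := (lact lR).
Local Notation lT := (lax_comp lR lG).
Local Notation "X ⊛ Y" := (tens (Monoidal := EM_mon V) X Y) (at level 39, left associativity).
Local Notation IV := (munit (Monoidal := EM_mon V)).
Local Notation q := (quo V).

(** * Cancellation and descent along [quo] *)

Lemma quo_epi (X Y : EM T) (Z : C) (x y : hom (U (X ⊛ Y)) Z) : x ∘ q X Y = y ∘ q X Y -> x = y.
Proof. exact: coeq_epi (quo_coequalizer V X Y) Z x y. Qed.

Lemma quo_whiskerr_epi (X Y : EM T) (W Z : C) (x y : hom (U (X ⊛ Y) ⊗ W) Z) :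
  x ∘ (q X Y ▷ W) = y ∘ (q X Y ▷ W) -> x = y.
Proof.
have [c _] := Htens (balance_reflexive pf X Y) (quo_coequalizer V X Y) W.
exact: coeq_epi c Z x y.
Qed.

Lemma quo_balanced (X Y : EM T) :
  q X Y ∘ (ac X ▷ U Y) = q X Y ∘ ((U X ◁ la Y) ∘ assoc (U X) M (U Y)).
Proof. by have [e _] := quo_coequalizer V X Y; rewrite balance_rE in e. Qed.

Lemma quo_desc (X Y : EM T) (Z : C) (h : hom (U X ⊗ U Y) Z) :
  h ∘ (ac X ▷ U Y) = h ∘ ((U X ◁ la Y) ∘ assoc (U X) M (U Y)) ->
  { k : hom (U (X ⊛ Y)) Z | k ∘ q X Y = h }.
Proof. by move=> e; apply: (coeq_desc (quo_coequalizer V X Y)); rewrite balance_rE. Qed.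

(** Linearity of the factorization is tested after [q X Y ▷ M], which is still epi because tensoring
    preserves reflexive coequalizers. *)
Lemma quo_desc_hom (X Y Z : EM T) (h : hom (U X ⊗ U Y) (U Z)) :
  h ∘ (ac X ▷ U Y) = h ∘ ((U X ◁ la Y) ∘ assoc (U X) M (U Y)) ->
  h ∘ ((U X ◁ ac Y) ∘ assoc (U X) (U Y) M) = ac Z ∘ (h ▷ M) ->
  { k : hom (X ⊛ Y) Z | under k ∘ q X Y = h }.
Proof.
move=> e e'; have [k ek] := quo_desc e.
have a : k ∘ ac (X ⊛ Y) = ac Z ∘ (k ▷ M).
  apply: quo_whiskerr_epi; asc.
  by rewrite quo_act (post1 ek) -tens_compr ek.
by exists (EM_hom pf a).
Qed.

(** * The laxity maps of [R] as balanced linear maps *)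

Lemma lact_comparison (X : D) : la (K X) = fmap R (lunit X) ∘ lax lR 𝟙 X.
Proof. exact: counit_rprojM. Qed.

(** Associativity of [lax lR] and the triangle identity let the middle copy of [M] be absorbed from
    either side with the same result. *)
Lemma lax_balanced (X Y : D) :
  lax lR X Y ∘ (ac (K X) ▷ R Y) = lax lR X Y ∘ ((R X ◁ la (K Y)) ∘ assoc (R X) M (R Y)).
Proof.
rewrite act_comparison lact_comparison tens_compr tens_compl; asc.
by rewrite (post (lax_naturall _ _ _)) (post (lax_naturalr _ _ _)) -lax_assoc fmap_post triangle.
Qed.

Lemma lax_act (X Y : D) :
  lax lR X Y ∘ ((R X ◁ ac (K Y)) ∘ assoc (R X) (R Y) M) = ac (K (X ⊗ Y)) ∘ (lax lR X Y ▷ M).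
Proof.
rewrite !act_comparison tens_compl; asc.
by rewrite (post (lax_naturalr _ _ _)) -lax_assoc fmap_post runit_tens.
Qed.

Lemma lax_comparison_sig (X Y : D) :
  { k : hom (K X ⊛ K Y) (K (X ⊗ Y)) | under k ∘ q (K X) (K Y) = lax lR X Y }.
Proof.
exact: (quo_desc_hom (X := K X) (Y := K Y) (Z := K (X ⊗ Y)) (lax_balanced X Y) (lax_act X Y)).
Qed.

(** * The unit object of [V] *)

Lemma unitM_comparison_act : unitM V ∘ ac (K 𝟙) = ac IV ∘ (unitM V ▷ M).
Proof. by rewrite unitM_act act_comparison -lunit_runit1. Qed.

(** [K 𝟙] is the regular module [M], while [IV] is known only up to isomorphism. Structure maps out
    of [IV] are built through the inverse of this map. *)
Definition unitM_hom : hom (K 𝟙) IV := EM_hom pf unitM_comparison_act.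

Lemma unitM_hom_inv_sig : { k : hom IV (K 𝟙) | is_inverse unitM_hom k }.
Proof.
have i : is_inverse (under unitM_hom) (inverse (unitM_iso V)) by apply: inverseP.
by exists (EM_inv pf i); apply: EM_invP.
Qed.


Lemma quo_unit_lunit (Y : EM T) :
  under (lunit (Monoidal := EM_mon V) Y) ∘ (q IV Y ∘ ((unitM V ∘ etaM) ▷ U Y)) = lunit (U Y).
Proof. by rewrite tens_compr -(comp_assoc (q _ _)) (post1 (quo_lunit V Y)) lactE lact_eta. Qed.

Lemma quo_unit_runit (X : EM T) :
  under (runit (Monoidal := EM_mon V) X) ∘ (q X IV ∘ (U X ◁ (unitM V ∘ etaM))) = runit (U X).
Proof. by rewrite tens_compl -(comp_assoc (q _ _)) (post1 (quo_runit V X)) act_eta. Qed.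

Lemma under_inverse (X Y : EM T) (f : hom X Y) g : is_inverse f g -> is_inverse (under f) (under g).
Proof. exact: (fmap_inverse (Forg T)). Qed.

(** The cancelled map is the inverse left unitor of [V] after the left unitor of [C], hence
    invertible. Testing against it reduces the unit laws of a lifted structure to unit laws in
    [C]. *)
Lemma quo_unitl_epi (Y : EM T) (Z : C) (x y : hom (U (IV ⊛ Y)) Z) :
  x ∘ (q IV Y ∘ ((unitM V ∘ etaM) ▷ U Y)) = y ∘ (q IV Y ∘ ((unitM V ∘ etaM) ▷ U Y)) -> x = y.
Proof.
have i := under_inverse (lunit_iso (Monoidal := EM_mon V) Y).
have -> : q IV Y ∘ ((unitM V ∘ etaM) ▷ U Y) =
    under (lunit_inv (Monoidal := EM_mon V) Y) ∘ lunit (U Y).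
  by apply: (iso_mono i); rewrite quo_unit_lunit -comp_assoc (proj2 i) comp_idl.
by rewrite -!comp_assoc => /(iso_epi (lunit_iso _)); case: i => e e'; apply: (iso_epi (conj e' e)).
Qed.

Lemma quo_unitr_epi (X : EM T) (Z : C) (x y : hom (U (X ⊛ IV)) Z) :
  x ∘ (q X IV ∘ (U X ◁ (unitM V ∘ etaM))) = y ∘ (q X IV ∘ (U X ◁ (unitM V ∘ etaM))) -> x = y.
Proof.
have i := under_inverse (runit_iso (Monoidal := EM_mon V) X).
have -> : q X IV ∘ (U X ◁ (unitM V ∘ etaM)) =
    under (runit_inv (Monoidal := EM_mon V) X) ∘ runit (U X).
  by apply: (iso_mono i); rewrite quo_unit_runit -comp_assoc (proj2 i) comp_idl.
by rewrite -!comp_assoc => /(iso_epi (runit_iso _)); case: i => e e'; apply: (iso_epi (conj e' e)).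
Qed.

(** * Lifting lax structures along [Forg] *)

Section LaxLift.
Context (E : Category) (ME : Monoidal E) (F : Functor E (EM T)).
Context (l : LaxMonoidal (functor_comp (Forg T) F)).
Context (φ : forall A B : E, hom (F A ⊛ F B) (F (A ⊗ B))) (φ0 : hom IV (F 𝟙)).
Context (φE : forall A B : E, under (φ A B) ∘ q (F A) (F B) = lax l A B).
Context (φ0E : under φ0 ∘ (unitM V ∘ etaM) = lax0 l).

Local Notation "f ⊛₁ g" := (tensm (Monoidal := EM_mon V) f g) (at level 39, left associativity).

Lemma lift_natural (A A' B B' : E) (f : hom A A') (g : hom B B') :
  φ A' B' ∘ (fmap F f ⊛₁ fmap F g) = fmap F (f ⊗₁ g) ∘ φ A B.
Proof.
apply: AlgebraHom_eq; apply: quo_epi; rewrite /= !comp_assoc quo_tensm (post1 (φE _ _)) φE.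
exact: (lax_natural l f g).
Qed.

Lemma lift_assoc (A B Z : E) :
  fmap F (assoc A B Z) ∘ (φ (A ⊗ B) Z ∘ (φ A B ⊛₁ idm (F Z))) =
  φ A (B ⊗ Z) ∘ ((idm (F A) ⊛₁ φ B Z) ∘ assoc (Monoidal := EM_mon V) (F A) (F B) (F Z)).
Proof.
apply: AlgebraHom_eq; apply: quo_epi; apply: quo_whiskerr_epi.
rewrite /= !comp_assoc quo_assoc (post (quo_tensm _ _ _)) (post (quo_tensm _ _ _)) /=.
rewrite !(post1 (φE _ _)) -tens_compr φE -(comp_assoc (_ ◁ _)) -tens_compl φE.
exact: (lax_assoc l A B Z).
Qed.

Lemma lift_lunit (A : E) :
  fmap F (lunit A) ∘ (φ 𝟙 A ∘ (φ0 ⊛₁ idm (F A))) = lunit (Monoidal := EM_mon V) (F A).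
Proof.
apply: AlgebraHom_eq; apply: quo_unitl_epi.
rewrite quo_unit_lunit /= !comp_assoc (post (quo_tensm _ _ _)) /=.
rewrite (post1 (φE _ _)) -tens_compr φ0E; exact: (lax_lunit l A).
Qed.

Lemma lift_runit (A : E) :
  fmap F (runit A) ∘ (φ A 𝟙 ∘ (idm (F A) ⊛₁ φ0)) = runit (Monoidal := EM_mon V) (F A).
Proof.
apply: AlgebraHom_eq; apply: quo_unitr_epi.
rewrite quo_unit_runit /= !comp_assoc (post (quo_tensm _ _ _)) /=.
rewrite (post1 (φE _ _)) -tens_compl φ0E; exact: (lax_runit l A).
Qed.

(** [Forg] is faithful, so each law is an equation in [C]; after precomposition with a suitable
    epimorphism it becomes the same law for [l]. *)
Definition lax_lift : LaxMonoidal (MD := V) F :=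
  @Build_LaxMonoidal _ _ ME V F φ φ0 lift_natural lift_assoc lift_lunit lift_runit.

End LaxLift.

(** * Lax structures on the comparison functor and on [Forg] *)

Definition unitM_hom_inv := proj1_sig unitM_hom_inv_sig.

Lemma unitM_hom_invP : is_inverse unitM_hom unitM_hom_inv.
Proof. exact: proj2_sig. Qed.

Lemma unitM_hom_invE : under unitM_hom_inv ∘ unitM V = idm M.
Proof. exact: (proj1 (under_inverse unitM_hom_invP)). Qed.

(** [Forg T] after [K] is [R] up to conversion, so the fields of [lR] are only retyped. *)
Definition lax_Forg_comparison : LaxMonoidal (functor_comp (Forg T) K) :=
  @Build_LaxMonoidal _ _ MD MC (functor_comp (Forg T) K) (lax lR) (lax0 lR)
    (lax_natural lR) (lax_assoc lR) (lax_lunit lR) (lax_runit lR).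

Lemma lax_comparison_exists : exists lK : LaxMonoidal (MD := V) K, is_lax_comparison lK.
Proof.
have e0 : under unitM_hom_inv ∘ (unitM V ∘ etaM) = lax0 lax_Forg_comparison.
  by rewrite -comp_assoc unitM_hom_invE comp_idl.
exists (lax_lift (l := lax_Forg_comparison) (fun X Y => proj2_sig (lax_comparison_sig X Y)) e0).
by split=> [X Y|]; [apply: (proj2_sig (lax_comparison_sig X Y)) | apply: unitM_hom_invE].
Qed.

Definition lax_Forg : LaxMonoidal (MC := V) (Forg T).
Proof.
refine (@Build_LaxMonoidal _ _ V MC (Forg T) q (unitM V ∘ etaM) _ _ _ _).
- by move=> X X' Y Y' f g; rewrite -(quo_tensm V f g).
- by move=> X Y Z; apply: quo_assoc.
- by move=> Y; apply: quo_unit_lunit.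
- by move=> X; apply: quo_unit_runit.
Defined.

(** * Laxity of [T] and of [Free] *)

Lemma lax_mid (A : C) (X : D) :
  lax lR (G A) X ∘ ((unit adj A ⊗₁ (fmap R (lunit X) ∘ lax lR 𝟙 X)) ∘ assoc A M (R X)) =
  lax lR (G A) X ∘ (lp A ▷ R X).
Proof.
rewrite tensm_rl tens_compl; asc; rewrite -nat1 (post (lax_naturalr _ _ _)).
rewrite -(comp_assoc (_ ◁ _)) -(comp_assoc (lax _ _ _)) -lax_assoc; asc.
rewrite [in LHS]fmap_post triangle -(post (lax_naturall _ _ _)) -!tens_compr.
by rewrite /lprojM /lproj.
Qed.

(** The copy of [M] coming from [lp A] is moved onto [T B] by [lax_mid]; acting there from the left
    is swapping past [B] and multiplying. *)
Lemma lax_monad_lprojM (A B : C) :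
  lax lT A B ∘ (lp A ⊗₁ lp B) = lp (A ⊗ B) ∘ free_tensor pf A B.
Proof.
rewrite (lprojM_tens Hadj) /free_tensor [lax lT A B]/=; asc.
rewrite (post (nat3 _ _ _)) assocKV_post.
(* [b] is the left action of [M] on [T B]; [e] computes it on [B ⊗ M], using that left and right
   actions commute ([projM_bi]). *)
set b := fmap R (lunit (G B)) ∘ lax lR 𝟙 (G B).
have e : lp B ∘ ((B ◁ mul) ∘ (assoc B M M ∘ ((sw B ▷ M) ∘ assoc_inv M B M))) = b ∘ (M ◁ lp B).
  rewrite -(comp_assoc (B ◁ _)) -(comp_assoc (lp B)) -lprojM_mul; asc.
  rewrite -(comp_assoc (_ ▷ _)) -tens_compr lprojM_swap.
  rewrite -(comp_assoc (lax _ _ _)) -(comp_assoc (fmap R (runit _))) projM_bi; asc.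
  by rewrite assocKV comp_idr /b; asc.
have -> : lax lR (G A) (G B) ∘ (lp A ⊗₁ lp B) =
    lax lR (G A) (G B) ∘ ((unit adj A ⊗₁ (b ∘ (M ◁ lp B))) ∘ assoc A M (B ⊗ M)).
  rewrite tensm_lr -(post (lax_mid A (G B))) -/b; asc.
  by rewrite nat3 -(comp_assoc (_ ⊗₁ _)) -tensm_comp comp_idr.
rewrite -e -{1}(comp_idr (unit adj A)) tensm_comp; asc; rewrite !tens_compl; by asc.
Qed.

(** [Free T A] has the carrier and action of [K (G A)], so [lax lR (G A) (G B)] is already balanced
    and linear; it is followed by the algebra map [fmap K (lax lG A B)]. *)
Lemma lax_Free_sig (A B : C) :
  { k : hom (Free T A ⊛ Free T B) (Free T (A ⊗ B)) |
    under k ∘ q (Free T A) (Free T B) = lax lT A B }.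
Proof.
apply: quo_desc_hom.
  rewrite /= !comp_assoc; congr (_ ∘ _); exact: lax_balanced.
rewrite [lax lT A B]/= tens_compr.
rewrite -(post (under_act lR (fmap K (lax lG A B)))) comp_assoc; congr (_ ∘ _).
exact: (lax_act (G A) (G B)).
Qed.

Lemma comparison_Free_alg (A : C) :
  idm (T A) ∘ alg (K (G A)) = alg (Free T A) ∘ fmap T (idm (T A)).
Proof. by rewrite fmap_id comp_idl comp_idr. Qed.

(** The two algebras have the same carrier and action but separate proofs of the algebra laws, so
    the identity is packaged as a morphism. *)
Definition comparison_Free (A : C) : hom (K (G A)) (Free T A) :=
  @Build_AlgebraHom _ T (K (G A)) (Free T A) (idm (T A)) (comparison_Free_alg A).

Definition lax0_Free : hom IV (Free T 𝟙) :=
  comparison_Free 𝟙 ∘ (fmap K (lax0 lG) ∘ unitM_hom_inv).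

Lemma lax0_FreeE : under lax0_Free ∘ unitM V = fmap R (lax0 lG).
Proof.
rewrite [under _]/= comp_idl comp_assoc.
have -> : under unitM_hom_inv ∘ unitM V = idm M := unitM_hom_invE.
by rewrite comp_idr.
Qed.

Definition lax_Forg_Free : LaxMonoidal (functor_comp (Forg T) (Free T)) :=
  @Build_LaxMonoidal _ _ MC MC (functor_comp (Forg T) (Free T)) (lax lT) (lax0 lT)
    (lax_natural lT) (lax_assoc lT) (lax_lunit lT) (lax_runit lT).

Lemma lax0_Free_eta : under lax0_Free ∘ (unitM V ∘ etaM) = lax0 lax_Forg_Free.
Proof. by rewrite -comp_assoc lax0_FreeE. Qed.

Definition lax_Free : LaxMonoidal (MD := V) (Free T) :=
  lax_lift (l := lax_Forg_Free) (fun A B => proj2_sig (lax_Free_sig A B)) lax0_Free_eta.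

Lemma lax_FreeE (A B : C) : under (lax lax_Free A B) ∘ q (Free T A) (Free T B) = lax lT A B.
Proof. exact: (proj2_sig (lax_Free_sig A B)). Qed.

Lemma lax_FreeP : is_lax_Free lG lax_Free.
Proof.
split=> [A B|]; last exact: lax0_FreeE.
by rewrite -lax_monad_lprojM -comp_assoc lax_FreeE.
Qed.

(** * Monoidality of the unit and counit *)

Lemma EM_unit_monoidal :
  is_monoidal_transformation (lax_id MC) (lax_comp lax_Forg lax_Free) (unit (EM_adj T)).
Proof.
have [n e e0] := unit_monoidal Hadj; split.
- exact: (unit_natural (EM_adj T)).
- move=> A B; rewrite [LHS]e; congr (_ ∘ _); exact: eq_sym (lax_FreeE A B).
- rewrite [LHS]e0; exact: eq_sym lax0_Free_eta.
Qed.

Lemma tensm_iso_epi (A A' B B' Z : C) (f : hom A A') f' (g : hom B B') g' (x y : hom (A' ⊗ B') Z) :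
  is_inverse f f' -> is_inverse g g' -> x ∘ (f ⊗₁ g) = y ∘ (f ⊗₁ g) -> x = y.
Proof.
move=> i j; rewrite tensm_rl -!comp_assoc => /(iso_epi (inverse_whiskerr _ i)).
exact: iso_epi (inverse_whiskerl _ j).
Qed.

Lemma act_mul_swap (X : EM T) :
  ac X ∘ ((U X ◁ mul) ∘ (assoc (U X) M M ∘ ((sw (U X) ▷ M) ∘ assoc_inv M (U X) M))) =
  la X ∘ (M ◁ ac X).
Proof.
rewrite -(comp_assoc (U X ◁ _)) -(post (act_act lR X)) -(comp_assoc (_ ▷ M)) -tens_compr lactE.
rewrite (post (act_lact lR X)); asc; by rewrite assocKV comp_idr.
Qed.

(** Balancing turns the action on [X] into a left action on [Y], which [act_mul_swap] rewrites by
    swap and multiplication. *)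
Lemma quo_free_tensor (X Y : EM T) :
  q X Y ∘ ((U X ◁ ac Y) ∘ (assoc (U X) (U Y) M ∘ free_tensor pf (U X) (U Y))) =
  q X Y ∘ (ac X ⊗₁ ac Y).
Proof.
rewrite /free_tensor; asc; rewrite (post (nat3 _ _ _)) assocKV_post.
rewrite (tensm_lr (ac X) (ac Y)) (post (quo_balanced X Y)); asc; rewrite nat3.
rewrite -[in RHS](comp_assoc (_ ◁ _)) -[in RHS]tens_compl -act_mul_swap !tens_compl; by asc.
Qed.

(** This is [quo_free_tensor] transported along the isomorphisms [lp]; it gives the tensor law of
    the counit. *)
Lemma alg_quo_lax (X Y : EM T) :
  alg (X ⊛ Y) ∘ (fmap T (q X Y) ∘ lax lT (U X) (U Y)) = q X Y ∘ (alg X ⊗₁ alg Y).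
Proof.
apply: (tensm_iso_epi (lprojM_iso pf (U X)) (lprojM_iso pf (U Y))).
asc; rewrite -tensm_comp -quo_free_tensor -(comp_assoc (_ ◁ _)) -(post (quo_act V X Y)) lax_monad_lprojM.
by rewrite -[fmap T _ ∘ _](post (lprojM_natural adj lR (q X Y))) -comp_assoc.
Qed.

Lemma EM_counit_monoidal :
  is_monoidal_transformation (lax_comp lax_Free lax_Forg) (lax_id V) (counit (EM_adj T)).
Proof.
split.
- exact: (counit_natural (EM_adj T)).
- move=> X Y; apply: AlgebraHom_eq; apply: quo_epi.
  rewrite -[LHS]/(alg (X ⊛ Y) ∘ (fmap T (q X Y) ∘ under (lax lax_Free (U X) (U Y))) ∘
    q (Free T (U X)) (Free T (U Y))).
  by rewrite !comp_assoc lax_FreeE alg_quo_lax [under _]/= comp_idl quo_tensm.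
(* Since [unitM_hom] is an algebra isomorphism, the unit law can be checked on [K 𝟙], where it is
   the image under [R] of the unit law of [counit adj]. *)
- apply: AlgebraHom_eq; apply: (iso_epi (under_inverse unitM_hom_invP)).
  have [_ _ /= e0] := counit_monoidal Hadj.
  rewrite -[LHS]/(alg IV ∘ (fmap T (unitM V ∘ etaM) ∘ under lax0_Free) ∘ unitM V).
  asc; rewrite lax0_FreeE.
  rewrite fmap_comp; asc; rewrite -(post (under_alg unitM_hom)).
  rewrite -[X in _ ∘ X]/(fmap R (counit adj 𝟙) ∘ (fmap R (fmap G etaM) ∘ fmap R (lax0 lG))).
  by rewrite -!fmap_comp e0 fmap_id comp_idl comp_idr.
Qed.

Lemma EM_monoidal_adjunction : is_monoidal_adjunction (EM_adj T) lax_Free lax_Forg.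
Proof. split; [exact: EM_unit_monoidal | exact: EM_counit_monoidal]. Qed.

(** * The projection formula for [Forg] *)

Lemma act_Free_unit (A : C) : ac (Free T A) ∘ (unit adj A ▷ M) = lp A.
Proof.
rewrite /act comp_assoc (lprojM_natural adj lR (unit adj A)) -comp_assoc.
by rewrite [X in X ∘ _](mu_etar T A) comp_idl.
Qed.

Lemma lact_Free_unit (A : C) : la (Free T A) ∘ (M ◁ unit adj A) = rp A.
Proof.
rewrite /lact comp_assoc (rprojM_natural adj lR (unit adj A)) -comp_assoc.
by rewrite [X in X ∘ _](mu_etar T A) comp_idl.
Qed.

Lemma act_Free (A : C) :
  ac (Free T A) ∘ (lp A ▷ M) = lp A ∘ ((A ◁ mul) ∘ assoc A M M).
Proof.
rewrite -lprojM_mul -(comp_assoc (fmap R _)); congr (_ ∘ _); exact: (act_comparison adj lR (G A)).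
Qed.

Lemma lact_Free (A : C) :
  la (Free T A) ∘ ((M ◁ rp A) ∘ assoc M M A) = rp A ∘ (mul ▷ A).
Proof.
rewrite -rprojM_mul -(comp_assoc (fmap R _)); congr (_ ∘ _); exact: (lact_comparison (G A)).
Qed.

Definition rprojM_inv (A : C) : hom (T A) (M ⊗ A) :=
  inverse (rproj_iso pf 𝟙 A) ∘ fmap R (lunit_inv (G A)).

Lemma rprojM_iso (A : C) : is_inverse (rp A) (rprojM_inv A).
Proof.
apply: inverse_comp; first by apply: fmap_inverse; apply: lunit_iso.
exact: inverseP.
Qed.

Lemma EM_lproj_iso (A : C) (X : EM T) : is_iso (lproj (EM_adj T) lax_Forg A X).
Proof.
have i : is_inverse (lp A ▷ U X) (lprojM_inv pf A ▷ U X).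
  exact: inverse_whiskerr (lprojM_iso pf A).
(* The candidate inverse before descent. Its balancedness, checked on [A ⊗ M ⊗ M ⊗ U X], is
   associativity of the left action on [X]. *)
have [h hE] : exists h : hom (T A ⊗ U X) (A ⊗ U X),
    h ∘ (lp A ▷ U X) = (A ◁ la X) ∘ assoc A M (U X).
  exists ((A ◁ la X) ∘ (assoc A M (U X) ∘ (lprojM_inv pf A ▷ U X))).
  by asc; rewrite (proj1 i) comp_idr.
have [|k kE] := quo_desc (X := Free T A) (Y := X) (h := h).
  apply: (iso_epi (inverse_whiskerr (U X) (inverse_whiskerr M (lprojM_iso pf A)))).
  asc; rewrite nat1 -(post (exch _ _)) (post hE) -tens_compr act_Free tens_compr (post hE).
  asc; rewrite (post (nat3 _ _ _)) pentagon tens_compr (post (nat2 _ _ _)).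
  rewrite -!(comp_assoc (A ◁ _)) -!tens_compl -lact_lact !tens_compl; by asc.
(* The unit at [A] inserts [etaM] as seen through [lp], so [k] undoes it by unitality of the action
   on [X]. *)
have etaE : (unit adj A ▷ U X) ∘ (runit A ▷ U X) = (lp A ▷ U X) ∘ ((A ◁ etaM) ▷ U X).
  by rewrite -!tens_compr lprojM_eta.
rewrite -[lproj _ _ _ _]/(q (Free T A) X ∘ (unit adj A ▷ U X)); exists k; split.
  rewrite (post1 kE).
  apply: (iso_epi (inverse_whiskerr (U X) (runit_iso A))).
  rewrite comp_assoc etaE (post hE) nat2 -(comp_assoc (_ ◁ _)) -tens_compl lact_eta.
  by rewrite triangle comp_idl.
(* For the other composite, balancing moves the action on [X] back to [Free T A], where acting on
   the unit recovers [lp]. *)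
apply: quo_epi; apply: (iso_epi i).
asc; rewrite (post1 kE) comp_idl; asc; rewrite hE.
rewrite (post (exch (unit adj A) (la X))) -nat1 -(comp_assoc (_ ◁ _)) -(post (quo_balanced (Free T A) X)).
by rewrite -tens_compr act_Free_unit.
Qed.

Lemma EM_rproj_iso (X : EM T) (A : C) : is_iso (rproj (EM_adj T) lax_Forg X A).
Proof.
have i : is_inverse (U X ◁ rp A) (U X ◁ rprojM_inv A).
  exact: inverse_whiskerl (rprojM_iso A).
(* The mirror image, with [T A] identified with [M ⊗ A] by [rp]. The trailing [z] lets the equation
   rewrite inside right-nested composites. *)
have [h hE] : exists h : hom (U X ⊗ T A) (U X ⊗ A),
    forall Z (z : hom Z (U X ⊗ M ⊗ A)),
      h ∘ ((U X ◁ rp A) ∘ (assoc (U X) M A ∘ z)) = (ac X ▷ A) ∘ z.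
  exists ((ac X ▷ A) ∘ (assoc_inv (U X) M A ∘ (U X ◁ rprojM_inv A))).
  by move=> Z z; asc; rewrite (post1 (proj1 i)) comp_idl assocK_post.
have [|k kE] := quo_desc (X := X) (Y := Free T A) (h := h).
  apply: (iso_epi (inverse_whiskerl (U X ⊗ M) (rprojM_iso A))).
  apply: (iso_epi (assoc_iso (U X ⊗ M) M A)).
  asc; rewrite (post (exch _ _)) -nat1 hE -tens_compr act_act tens_compr -hE tens_compr.
  rewrite (post (nat3 _ _ _)) pentagon.
  do 2!rewrite -[in RHS](comp_assoc (U X ◁ _)) -[in RHS]tens_compl.
  asc; rewrite lact_Free [in RHS]tens_compl; asc; by rewrite (post (nat2 _ _ _)).
have etaE : (U X ◁ unit adj A) ∘ (U X ◁ lunit A) = (U X ◁ rp A) ∘ (U X ◁ (etaM ▷ A)).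
  by rewrite -!tens_compl rprojM_eta.
rewrite -[rproj _ _ _ _]/(q X (Free T A) ∘ (U X ◁ unit adj A)); exists k; split.
  rewrite (post1 kE).
  apply: (iso_epi (inverse_whiskerl (U X) (lunit_iso A))); apply: (iso_epi (assoc_iso _ _ _)).
  asc; rewrite (post etaE) -nat2 hE; asc.
  by rewrite -tens_compr act_eta comp_idl triangle.
apply: quo_epi; apply: (iso_epi i); apply: (iso_epi (assoc_iso _ _ _)).
asc; rewrite (post1 kE) comp_idl; asc.
rewrite -[assoc _ _ _]comp_idr hE !comp_idr.
rewrite -exch (post (quo_balanced X (Free T A))); asc.
by rewrite nat3 -(comp_assoc (_ ◁ _)) -tens_compl lact_Free_unit.
Qed.

Lemma EM_projection_formula : projection_formula (EM_adj T) lax_Forg.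
Proof. split; [exact: EM_lproj_iso | exact: EM_rproj_iso]. Qed.

End EilenbergMooreMonoidalAdjunction.

Theorem theorem5 (C D : Category) (MC : Monoidal C) (MD : Monoidal D)
    (G : Functor C D) (R : Functor D C) (adj : Adjunction G R)
    (lG : LaxMonoidal G) (lR : LaxMonoidal R)
    (Hadj : is_monoidal_adjunction adj lG lR)
    (pf : projection_formula adj lR)
    (Hcoeq : has_reflexive_coequalizers C)
    (Htens : tensor_preserves_reflexive_coequalizers MC)
    (V : EM_monoidal pf) :
  exists (lF : LaxMonoidal (MD := V) (Free (adj_monad adj)))
         (lU : LaxMonoidal (MC := V) (Forg (adj_monad adj)))
         (lK : LaxMonoidal (MD := V) (comparison adj)),
    (is_lax_Free lG lF /\ is_lax_Forg lU /\
     is_monoidal_adjunction (EM_adj (adj_monad adj)) lF lU) /\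
    is_lax_comparison lK /\
    projection_formula (EM_adj (adj_monad adj)) lU.
Proof.
have [lK lKP] := lax_comparison_exists Htens V.
exists (lax_Free lG Htens V), (lax_Forg V), lK; split; last first.
  by split=> //; apply: EM_projection_formula.
split; first exact: lax_FreeP.
by split; [split | exact: EM_monoidal_adjunction].
Qed.
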